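(* Let $D$ be a finite-dimensional $\mathbb Z_2^N$-graded division algebra over $\mathbb K=\mathbb R$ or $\mathbb C$ with $D_c\neq0$ for all $c\in\mathbb Z_2^N$. For a basis $z_1,\dots,z_N$ of $\mathbb Z_2^N$ put $D_i=D_0\oplus D_{z_i}$, a $\mathbb Z_2$-graded division algebra. (1) If $\mathbb K=\mathbb C$: generators $\theta_i\in D_{z_i}$ can be chosen with $\theta_i^2=1$ and $\theta_i$ commuting with $D_0=\mathbb C$; then $a_{ij}:=(\theta_i\theta_j)^2\in\{\pm1\}$ for $i\ne j$, and such $D$ are classified up to graded isomorphism by $(\{D_i\},\{a_{ij}\}_{i<j})$ with $a_{ij}=\pm1$ arbitrary (here each $D_i\cong(\mathbb C,\mathrm{id},1)$). (2) If $\mathbb K=\mathbb R$ and $D_0=\mathbb R$ or $\mathbb H$: generators $\theta_i\in D_{z_i}$ can be chosen commuting with $D_0$ with $\theta_i^2=\pm1$; then $a_{ij}:=(\theta_i\theta_j)^2\in\{\pm1\}$, and such $D$ with given $D_0$ are classified up to graded isomorphism by $(\{D_i\},\{a_{ij}\}_{i<j})$, where each $D_i\cong(D_0,\mathrm{id},\pm1)$ and $a_{ij}=\pm1$ are arbitrary. (3) If $\mathbb K=\mathbb R$, $D_0=\mathbb C$ and every homogeneous element of $D$ commutes with $D_0$: the classification is given by $(\{D_i\},\{a_{ij}\}_{i<j})$ as in (1), with $D_i$ a $\mathbb Z_2$-graded division $\mathbb C$-algebra and $a_{ij}=\pm1$. (4) If $\mathbb K=\mathbb R$, $D_0=\mathbb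 C$ and not every homogeneous element commutes with $D_0$: the basis can be chosen such that elements of $D_{z_1}$ act on $D_0$ by conjugation as complex conjugation, while elements of $D_{z_i}$, $i\ge2$, commute with $D_0$. With respect to such a basis, one can choose $\theta_1\in D_{z_1}$ with $\theta_1^2=\pm1$ and $\theta_i\in D_{z_i}$ with $\theta_i^2=1$ for $i\ge2$; then $a_{ij}:=(\theta_i\theta_j)^2\in\{\pm1\}$, and such $D$ (with this fixed basis) are classified up to graded isomorphism by $(\{D_i\},\{a_{ij}\}_{i<j})$, where $D_1\cong(\mathbb C,\overline{(-)},\pm1)$, $D_i\cong(\mathbb C,\mathrm{id},1)$ for $i\ge2$, and $a_{ij}=\pm1$.
   Context: A $\mathbb Z_2^N$-graded algebra $D=\bigoplus_c D_c$ is a graded division algebra if every nonzero homogeneous element is invertible; then $D_0$ is a division algebra ($\mathbb C$ if $\mathbb K=\mathbb C$; $\mathbb R,\mathbb C$ or $\mathbb H$ if $\mathbb K=\mathbb R$). Graded isomorphisms are algebra isomorphisms over $\mathbb K$ preserving the degree in $\mathbb Z_2^N$. For a division algebra $D_0$, an algebra automorphism $f$ of $D_0$ and $a\in D_0$ invertible with $f^2(d)=ada^{-1}$ and $f(a)=a$, the symbol $(D_0,f,a)$ denotes the $\mathbb Z_2$-graded division algebra $D_0\oplus D_0\theta$ with $\theta$ of degree 1, $\theta^2=a$, $\theta d\theta^{-1}=f(d)$. $\overline{(-)}$ is complex conjugation on $\mathbb C$. ''Classified by $(\{D_i\},\{a_{ij}\})$'' means: two such algebras are isomorphic as graded algebras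 if and only if the isomorphism types of the $D_i$ and the signs $a_{ij}$ coincide, and every choice of the listed data is realized. *)

(* Defs.v *)
From HB Require Import structures.
From mathcomp Require Import all_boot all_order all_algebra all_field.
From mathcomp Require Import reals complex.

Set Implicit Arguments.
Unset Strict Implicit.
Unset Printing Implicit Defensive.

Import Order.TTheory GRing.Theory Num.Theory.
Local Open Scope ring_scope.

Record gradedAlg (K : fieldType) (G : finZmodType) := GradedAlg {
  galg :> falgType K;
  gcomp : G -> {vspace galg};
  gcomp_direct : directv (\sum_c gcomp c)%VS;
  gcomp_full : (\sum_c gcomp c)%VS = fullv;
  gcomp1 : 1 \in gcomp 0;
  gcompM : forall (b c : G) (x y : galg),
    x \in gcomp b -> y \in gcomp c -> x * y \in gcomp (b + c)
}.
Arguments gcomp {K G} D c%_R : rename.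

Definition graded_division (K : fieldType) (G : finZmodType)
    (D : gradedAlg K G) : Prop :=
  forall (c : G) (x : D), x \in gcomp D c -> x != 0 -> x \is a GRing.unit.

Definition full_support (K : fieldType) (G : finZmodType)
    (D : gradedAlg K G) : Prop :=
  forall c : G, gcomp D c != 0%VS.

Definition full_division_alg (K : fieldType) (G : finZmodType)
    (D : gradedAlg K G) : Prop :=
  graded_division D /\ full_support D.

Definition is_graded_iso (K : fieldType) (G : finZmodType)
    (A B : gradedAlg K G) (f : {lrmorphism A -> B}) : Prop :=
  bijective f /\ forall (c : G) (x : A), x \in gcomp A c -> f x \in gcomp B c.

Definition graded_iso (K : fieldType) (G : finZmodType)
    (A B : gradedAlg K G) : Prop :=
  exists f : {lrmorphism A -> B}, is_graded_iso f.

Definition alg_iso (K : fieldType) (A B : falgType K) : Prop :=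
  exists f : {lrmorphism A -> B}, bijective f.

Definition identifies0 (K : fieldType) (G : finZmodType) (D0 : falgType K)
    (D : gradedAlg K G) (phi : {lrmorphism D0 -> D}) : Prop :=
  injective phi /\ forall x : D, x \in gcomp D 0 <-> exists d, phi d = x.

Definition degree0_is (K : fieldType) (G : finZmodType) (D : gradedAlg K G)
    (D0 : falgType K) : Prop :=
  exists phi : {lrmorphism D0 -> D}, identifies0 phi.

Definition commutes_with0 (K : fieldType) (G : finZmodType)
    (D : gradedAlg K G) (x : D) : Prop :=
  forall d : D, d \in gcomp D 0 -> x * d = d * x.

Definition homogeneous_commute0 (K : fieldType) (G : finZmodType)
    (D : gradedAlg K G) : Prop :=
  forall (c : G) (x : D), x \in gcomp D c -> commutes_with0 x.

Lemma F2_sum (V : nmodType) (F : 'F_2 -> V) : \sum_c F c = F 0 + F 1.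
Proof.
rewrite (bigD1 (0 : 'F_2)) //=; congr (_ + _).
by rewrite (bigD1 (1 : 'F_2)) //= big1 ?addr0 // => -[[|[|]]].
Qed.

Section Z2Graded.
Variables (K : fieldType) (A : falgType K) (V0 V1 : {vspace A}).

Definition Z2comp (c : 'F_2) : {vspace A} := if c == 0 then V0 else V1.

Lemma F2_sumv : (\sum_c Z2comp c = V0 + V1)%VS.
Proof.
rewrite (bigD1 (0 : 'F_2)) //=; congr (_ + _)%VS.
by rewrite (bigD1 (1 : 'F_2)) //= big1 ?addv0 // => -[[|[|]]].
Qed.

Hypothesis cap0 : (V0 :&: V1 = 0)%VS.
Hypothesis sum1 : (V0 + V1 = fullv)%VS.
Hypothesis one0 : 1 \in V0.
Hypothesis mul00 : {in V0 & V0, forall x y, x * y \in V0}.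
Hypothesis mul01 : {in V0 & V1, forall x y, x * y \in V1}.
Hypothesis mul10 : {in V1 & V0, forall x y, x * y \in V1}.
Hypothesis mul11 : {in V1 & V1, forall x y, x * y \in V0}.

Lemma Z2comp_direct : directv (\sum_c Z2comp c)%VS.
Proof.
apply/directv_sum_independent => us Vus; rewrite F2_sum => us0.
have [u0 u1] : us 0 = 0 /\ us 1 = 0.
  have Vu0 : us 0 \in V0 := Vus 0 isT.
  have Vu1 : us 1 \in V1 := Vus 1 isT.
  have u01 : us 0 = - us 1 by apply/eqP; rewrite -addr_eq0 us0.
  have /eqP u0 : us 0 == 0.
    by rewrite -memv0 -cap0 memv_cap Vu0 u01 memvN.
  by split=> //; apply/eqP; rewrite -oppr_eq0 -u01 u0.
case=> [[|[|k]]] // lt_c _; first by rewrite -[RHS]u0; congr us; apply: val_inj.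
by rewrite -[RHS]u1; congr us; apply: val_inj.
Qed.

Lemma Z2comp_mul (b c : 'F_2) (x y : A) :
  x \in Z2comp b -> y \in Z2comp c -> x * y \in Z2comp (b + c).
Proof.
case: b c => [[|[|k]]] // ? [[|[|l]]] // ?; rewrite /Z2comp /=;
  [exact: mul00 | exact: mul01 | exact: mul10 | exact: mul11].
Qed.

Definition Z2graded : gradedAlg K 'F_2 :=
  @GradedAlg K 'F_2 A Z2comp Z2comp_direct (etrans F2_sumv sum1) one0
    Z2comp_mul.

End Z2Graded.

Section Z2sub.
Variables (K : fieldType) (N : nat) (D : gradedAlg K 'rV['F_2]_N).
Variable c : 'rV['F_2]_N.

(* Z2sub below is the algebra D_0 + D_c, with odd part D_c. For c = 0  *)
(* (which never occurs in a basis) the odd part is set to 0, so that the sum  *)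
(* is direct for every c.                                                     *)
Definition Z2sub_odd : {vspace D} := if c == 0 then 0%VS else gcomp D c.

Definition Z2sub_space : {vspace D} := (gcomp D 0 + Z2sub_odd)%VS.

Lemma Z2sub_cap : (gcomp D 0 :&: Z2sub_odd = 0)%VS.
Proof.
rewrite /Z2sub_odd; case: eqP => [_|/eqP c0]; first by rewrite capv0.
apply/eqP; rewrite -subv0; have /directv_sumP/(_ 0 isT) <- := gcomp_direct D.
by apply: capvS => //; apply: (sumv_sup c).
Qed.

Lemma F2_addrr (u : 'rV['F_2]_N) : u + u = 0.
Proof.
by apply/rowP => i; rewrite !mxE; case: (u 0 i) => [[|[|j]]] ltj; apply/eqP.
Qed.

Lemma Z2sub00 : {in gcomp D 0 & gcomp D 0, forall x y, x * y \in gcomp D 0}.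
Proof. by move=> x y Dx Dy; have := gcompM Dx Dy; rewrite addr0. Qed.

Lemma Z2sub01 : {in gcomp D 0 & Z2sub_odd, forall x y, x * y \in Z2sub_odd}.
Proof.
rewrite /Z2sub_odd => x y Dx; case: eqP => [_|_ Dy].
  by rewrite !memv0 => /eqP->; rewrite mulr0.
by have := gcompM Dx Dy; rewrite add0r.
Qed.

Lemma Z2sub10 : {in Z2sub_odd & gcomp D 0, forall x y, x * y \in Z2sub_odd}.
Proof.
rewrite /Z2sub_odd => x y; case: eqP => [_|_ Dx Dy].
  by rewrite !memv0 => /eqP->; rewrite mul0r.
by have := gcompM Dx Dy; rewrite addr0.
Qed.

Lemma Z2sub11 : {in Z2sub_odd & Z2sub_odd, forall x y, x * y \in gcomp D 0}.
Proof.
rewrite /Z2sub_odd => x y; case: eqP => [_|_ Dx Dy].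
  by rewrite memv0 => /eqP-> _; rewrite mul0r mem0v.
by have := gcompM Dx Dy; rewrite F2_addrr.
Qed.

Lemma Z2sub_one : 1 \in Z2sub_space.
Proof. by rewrite (subvP (addvSl _ _)) // gcomp1. Qed.

Lemma Z2sub_is_aspace : is_aspace Z2sub_space.
Proof.
rewrite /is_aspace has_algid1 ?Z2sub_one //=; apply/prodvP => u v.
move=> /memv_addP[x0 Dx0 [x1 Dx1 ->]] /memv_addP[y0 Dy0 [y1 Dy1 ->]].
rewrite mulrDl !mulrDr addrACA [x0 * y1 + _]addrC addrACA.
rewrite [x0 * y0 + _ + _]addrACA -!addrA addrA.
have E0 := Z2sub00 Dx0 Dy0; have E1 := Z2sub11 Dx1 Dy1.
have O0 := Z2sub01 Dx0 Dy1; have O1 := Z2sub10 Dx1 Dy0.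
have sE := subvP (addvSl (gcomp D 0) Z2sub_odd).
have sO := subvP (addvSr (gcomp D 0) Z2sub_odd).
by rewrite !memvD // ?(sE _ E0) ?(sE _ E1) ?(sO _ O0) ?(sO _ O1).
Qed.

Definition Z2sub_aspace : {aspace D} := ASpace Z2sub_is_aspace.

Definition Z2sub_part (V : {vspace D}) : {vspace subvs_of Z2sub_aspace} :=
  (linfun (vsval : subvs_of Z2sub_aspace -> D) @^-1: V)%VS.

Lemma mem_Z2sub_part V x : (x \in Z2sub_part V) = (vsval x \in V).
Proof. by rewrite -memv_preim lfunE. Qed.

Lemma Z2sub_part_cap : (Z2sub_part (gcomp D 0) :&: Z2sub_part Z2sub_odd = 0)%VS.
Proof.
apply/eqP; rewrite -subv0; apply/subvP => x.
rewrite memv_cap !mem_Z2sub_part -memv_cap Z2sub_cap !memv0 => /eqP x0.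
by apply/eqP/val_inj.
Qed.

Lemma Z2sub_part_sum : (Z2sub_part (gcomp D 0) + Z2sub_part Z2sub_odd = fullv)%VS.
Proof.
apply/eqP; rewrite eqEsubv subvf; apply/subvP => x _.
have /memv_addP[x0 Dx0 [x1 Dx1 xE]] := subvsP x.
have sE := subvP (addvSl (gcomp D 0) Z2sub_odd) _ Dx0.
have sO := subvP (addvSr (gcomp D 0) Z2sub_odd) _ Dx1.
apply/memv_addP; exists (Subvs sE : subvs_of Z2sub_aspace).
  by rewrite mem_Z2sub_part.
exists (Subvs sO : subvs_of Z2sub_aspace); first by rewrite mem_Z2sub_part.
exact: val_inj.
Qed.

Lemma Z2sub_part_one : 1 \in Z2sub_part (gcomp D 0).
Proof.
have /eqP alg1 : algid Z2sub_aspace == 1 by rewrite algid_eq1 Z2sub_one.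
by rewrite mem_Z2sub_part [vsval _]alg1 gcomp1.
Qed.

Lemma Z2sub_partM (U V W : {vspace D}) :
  {in U & V, forall x y, x * y \in W} ->
  {in Z2sub_part U & Z2sub_part V, forall x y, x * y \in Z2sub_part W}.
Proof. by move=> UVW x y; rewrite !mem_Z2sub_part => Ux Vy; apply: UVW. Qed.

Definition Z2sub : gradedAlg K 'F_2 :=
  Z2graded Z2sub_part_cap Z2sub_part_sum Z2sub_part_one (Z2sub_partM Z2sub00)
    (Z2sub_partM Z2sub01) (Z2sub_partM Z2sub10) (Z2sub_partM Z2sub11).

Definition Z2sub_val (x : Z2sub) : D := vsval (x : subvs_of Z2sub_aspace).

Lemma Z2sub_graded_division : graded_division D -> graded_division Z2sub.
Proof.
move=> divD b x Dx x0; apply: (@vsval_unitr _ _ Z2sub_aspace).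
have vx0 : vsval (x : subvs_of Z2sub_aspace) != 0.
  by apply: contra_neq x0 => vx0; apply: val_inj.
have : vsval (x : subvs_of Z2sub_aspace) \in if b == 0 then gcomp D 0 else Z2sub_odd.
  by move: Dx; rewrite /= /Z2comp; case: ifP; rewrite mem_Z2sub_part.
case: ifP => _; first by move/divD; apply.
rewrite /Z2sub_odd; case: ifP => _; last by move/divD; apply.
by rewrite memv0 (negPf vx0).
Qed.

End Z2sub.

(* f is automatically bijective: its square is an inner automorphism.         *)
Record crossedData (K : fieldType) := CrossedData {
  cr_base : falgType K;
  cr_aut : {lrmorphism cr_base -> cr_base};
  cr_sq : cr_base;
  cr_sq_unit : cr_sq \is a GRing.unit;
  cr_aut2 : forall d, cr_aut (cr_aut d) = cr_sq * d * cr_sq^-1;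
  cr_aut_sq : cr_aut cr_sq = cr_sq
}.

(* Crossed x y stands for x + y theta.                                        *)
Record crossed (K : fieldType) (d : crossedData K) := Crossed {
  crossed_fst : cr_base d;
  crossed_snd : cr_base d
}.

Section Crossed.
Variables (K : fieldType) (d : crossedData K).
Local Notation B := (cr_base d).
Local Notation f := (cr_aut d).
Local Notation a := (cr_sq d).
Local Notation fst_ := (@crossed_fst K d).
Local Notation snd_ := (@crossed_snd K d).

Definition crossed_pair (u : crossed d) : B * B := (fst_ u, snd_ u).
Definition pair_crossed (p : B * B) : crossed d := Crossed p.1 p.2.

Lemma crossed_pairK : cancel crossed_pair pair_crossed.
Proof. by case. Qed.

Lemma pair_crossedK : cancel pair_crossed crossed_pair.
Proof. by case. Qed.

HB.instance Definition _ := Choice.copy (crossed d) (can_type crossed_pairK).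

Lemma crossed_eq (u v : crossed d) : fst_ u = fst_ v -> snd_ u = snd_ v -> u = v.
Proof. by case: u v => [x1 x2] [y1 y2] /= -> ->. Qed.

Definition crossed_zero : crossed d := Crossed 0 0.
Definition crossed_opp (u : crossed d) : crossed d :=
  Crossed (- fst_ u) (- snd_ u).
Definition crossed_add (u v : crossed d) : crossed d :=
  Crossed (fst_ u + fst_ v) (snd_ u + snd_ v).
Definition crossed_scale (k : K) (u : crossed d) : crossed d :=
  Crossed (k *: fst_ u) (k *: snd_ u).

Lemma crossed_addA : associative crossed_add.
Proof. by move=> u v w; apply: crossed_eq; rewrite /= addrA. Qed.

Lemma crossed_addC : commutative crossed_add.
Proof. by move=> u v; apply: crossed_eq; rewrite /= addrC. Qed.

Lemma crossed_add0 : left_id crossed_zero crossed_add.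
Proof. by move=> u; apply: crossed_eq; rewrite /= add0r. Qed.

Lemma crossed_addN : left_inverse crossed_zero crossed_opp crossed_add.
Proof. by move=> u; apply: crossed_eq; rewrite /= addNr. Qed.

HB.instance Definition _ := GRing.isZmodule.Build (crossed d)
  crossed_addA crossed_addC crossed_add0 crossed_addN.

Lemma crossed_scaleA (k l : K) (u : crossed d) :
  crossed_scale k (crossed_scale l u) = crossed_scale (k * l) u.
Proof. by apply: crossed_eq; rewrite /= scalerA. Qed.

Lemma crossed_scale1 : left_id 1 crossed_scale.
Proof. by move=> u; apply: crossed_eq; rewrite /= scale1r. Qed.

Lemma crossed_scaleDr : right_distributive crossed_scale +%R.
Proof. by move=> k u v; apply: crossed_eq; rewrite /= scalerDr. Qed.

Lemma crossed_scaleDl (u : crossed d) :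
  {morph crossed_scale^~ u : k l / k + l}.
Proof. by move=> k l; apply: crossed_eq; rewrite /= scalerDl. Qed.

HB.instance Definition _ := GRing.Zmodule_isLmodule.Build K (crossed d)
  crossed_scaleA crossed_scale1 crossed_scaleDr crossed_scaleDl.

Lemma crossed_vector : SemiVector.axiom (dim (B * B)%type) (crossed d).
Proof.
have [r [rZ rD] r_bij] := VectorInternalTheory.v2r_subproof (B * B)%type.
exists (r \o crossed_pair).
  by split=> [k u|u v]; [apply: (rZ k (crossed_pair u))
    | apply: (rD (crossed_pair u) (crossed_pair v))].
apply: bij_comp r_bij _; exact: Bijective crossed_pairK pair_crossedK.
Qed.

HB.instance Definition _ := LSemiModule_hasFinDim.Build K (crossed d)
  crossed_vector.

Definition crossed_one : crossed d := Crossed 1 0.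

(* From theta y = f(y) theta and theta^2 = a.                                 *)
Definition crossed_mul (u v : crossed d) : crossed d :=
  Crossed (fst_ u * fst_ v + snd_ u * f (snd_ v) * a)
          (fst_ u * snd_ v + snd_ u * f (fst_ v)).

Lemma crossed_aut2 x : f (f x) * a = a * x.
Proof. by rewrite cr_aut2 divrK // cr_sq_unit. Qed.

Lemma crossed_mulA : associative crossed_mul.
Proof.
move=> [x1 x2] [y1 y2] [z1 z2]; apply: crossed_eq => /=.
  rewrite rmorphD !rmorphM /= !mulrDr !mulrDl !mulrA.
  rewrite -[x2 * f y2 * f (f z1) * a]mulrA crossed_aut2 !mulrA.
  by rewrite -!addrA; congr (_ + _); rewrite addrA addrC.
rewrite rmorphD !rmorphM /= !mulrDr !mulrDl !mulrA cr_aut_sq.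
rewrite -[x2 * f y2 * f (f z2) * a]mulrA crossed_aut2 !mulrA.
by rewrite -!addrA; congr (_ + _); rewrite addrA addrC.
Qed.

Lemma crossed_mul1l : left_id crossed_one crossed_mul.
Proof.
by move=> u; apply: crossed_eq; rewrite /= mul1r !mul0r addr0.
Qed.

Lemma crossed_mul1r : right_id crossed_one crossed_mul.
Proof.
move=> u; apply: crossed_eq; rewrite /= ?rmorph0 ?rmorph1.
  by rewrite mulr1 mulr0 mul0r addr0.
by rewrite mulr1 mulr0 add0r.
Qed.

Lemma crossed_mulDl : left_distributive crossed_mul +%R.
Proof.
by move=> u v w; apply: crossed_eq; rewrite /= !mulrDl addrACA.
Qed.

Lemma crossed_mulDr : right_distributive crossed_mul +%R.
Proof.
by move=> u v w; apply: crossed_eq; rewrite /= rmorphD !mulrDr ?mulrDl addrACA.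
Qed.

Lemma crossed_1neq0 : crossed_one != 0.
Proof. by apply/eqP => /(congr1 fst_)/eqP; rewrite oner_eq0. Qed.

HB.instance Definition _ := GRing.Zmodule_isNzRing.Build (crossed d)
  crossed_mulA crossed_mul1l crossed_mul1r crossed_mulDl crossed_mulDr
  crossed_1neq0.

Lemma crossed_scaleAl k (u v : crossed d) : k *: (u * v) = (k *: u) * v.
Proof. by apply: crossed_eq; rewrite /= scalerDr !scalerAl. Qed.

HB.instance Definition _ := GRing.Lmodule_isLalgebra.Build K (crossed d)
  crossed_scaleAl.

Lemma crossed_scaleAr k (u v : crossed d) : k *: (u * v) = u * (k *: v).
Proof.
apply: crossed_eq; rewrite /= linearZ /= scalerDr -!scalerAr //.
by rewrite -scalerAl.
Qed.

HB.instance Definition _ := GRing.Lalgebra_isAlgebra.Build K (crossed d)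
  crossed_scaleAr.

HB.instance Definition _ := Algebra_isFalgebra.Build K (crossed d).

Definition crossed_in (x : B) : crossed d := Crossed x 0.

Lemma crossed_fst_linear : linear fst_. Proof. by []. Qed.
Lemma crossed_snd_linear : linear snd_. Proof. by []. Qed.

HB.instance Definition _ := GRing.isLinear.Build K (crossed d) B _ fst_
  crossed_fst_linear.
HB.instance Definition _ := GRing.isLinear.Build K (crossed d) B _ snd_
  crossed_snd_linear.

Definition crossed_even : {vspace crossed d} := lker (linfun snd_).
Definition crossed_odd : {vspace crossed d} := lker (linfun fst_).

Lemma mem_crossed_even u : (u \in crossed_even) = (snd_ u == 0).
Proof. by rewrite memv_ker lfunE. Qed.

Lemma mem_crossed_odd u : (u \in crossed_odd) = (fst_ u == 0).
Proof. by rewrite memv_ker lfunE. Qed.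

Lemma crossed_cap : (crossed_even :&: crossed_odd = 0)%VS.
Proof.
apply/eqP; rewrite -subv0; apply/subvP => -[x y].
rewrite memv_cap mem_crossed_even mem_crossed_odd memv0 /=.
by move=> /andP[/eqP-> /eqP->].
Qed.

Lemma crossed_sum : (crossed_even + crossed_odd = fullv)%VS.
Proof.
apply/eqP; rewrite eqEsubv subvf; apply/subvP => -[x y] _.
apply/memv_addP; exists (Crossed x 0); first by rewrite mem_crossed_even.
exists (Crossed 0 y); first by rewrite mem_crossed_odd.
by apply: crossed_eq; rewrite /= ?addr0 ?add0r.
Qed.

Lemma crossed_one_even : 1 \in crossed_even.
Proof. by rewrite mem_crossed_even. Qed.

Lemma crossed00 :
  {in crossed_even & crossed_even, forall u v, u * v \in crossed_even}.
Proof.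
move=> u v; rewrite !mem_crossed_even /= => /eqP-> /eqP->.
by rewrite mulr0 mul0r addr0.
Qed.

Lemma crossed01 :
  {in crossed_even & crossed_odd, forall u v, u * v \in crossed_odd}.
Proof.
move=> u v; rewrite mem_crossed_even !mem_crossed_odd /= => /eqP-> /eqP->.
by rewrite mulr0 !mul0r addr0.
Qed.

Lemma crossed10 :
  {in crossed_odd & crossed_even, forall u v, u * v \in crossed_odd}.
Proof.
move=> u v; rewrite mem_crossed_even !mem_crossed_odd /= => /eqP-> /eqP->.
by rewrite rmorph0 mulr0 !mul0r addr0.
Qed.

Lemma crossed11 :
  {in crossed_odd & crossed_odd, forall u v, u * v \in crossed_even}.
Proof.
move=> u v; rewrite mem_crossed_even !mem_crossed_odd /= => /eqP-> /eqP->.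
by rewrite rmorph0 mulr0 !mul0r addr0.
Qed.

Definition crossed_graded : gradedAlg K 'F_2 :=
  Z2graded crossed_cap crossed_sum crossed_one_even
    crossed00 crossed01 crossed10 crossed11.

End Crossed.
Arguments crossed_in {K} d x.

Section IdCrossed.
Variables (K : fieldType) (D0 : falgType K) (s : bool).

Lemma sign_unit : (-1) ^+ s \is a @GRing.unit D0.
Proof. by rewrite unitrX // unitrN unitr1. Qed.

Lemma sign_comm (d : D0) : d = (-1) ^+ s * d * ((-1) ^+ s)^-1.
Proof. by rewrite -(commr_sign d s) mulrK // sign_unit. Qed.

(* (D0, id, (-1)^s) *)
Definition idData : crossedData K :=
  @CrossedData K D0 idfun ((-1) ^+ s) sign_unit sign_comm erefl.

End IdCrossed.

Section RealAlgebras.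
Variable R : realType.
Local Notation CR := (Rcomplex R).

Lemma Rcomplex_scaleAr (k : R) (x y : CR) : k *: (x * y) = x * (k *: y).
Proof. by rewrite mulrC scalerAl mulrC. Qed.

HB.instance Definition _ := GRing.Lalgebra_isAlgebra.Build R CR
  Rcomplex_scaleAr.

Definition Rcomplex_row (x : CR) : 'rV[R]_2 :=
  \row_j (if j == 0 then complex.Re x else complex.Im x).

Lemma Rcomplex_row_linear : linear Rcomplex_row.
Proof.
by move=> k [x1 x2] [y1 y2]; apply/rowP => j; rewrite !mxE; case: ifP.
Qed.

Lemma Rcomplex_row_bij : bijective Rcomplex_row.
Proof.
exists (fun v : 'rV[R]_2 => Complex (v 0 0) (v 0 1)) => [[x y]|v].
  by rewrite /Rcomplex_row !mxE.
apply/rowP => -[[|[|k]]] // lt_j; rewrite !mxE /=; congr (v 0 _); exact: val_inj.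
Qed.

Lemma Rcomplex_vector : Vector.axiom 2 CR.
Proof. by exists Rcomplex_row; [exact: Rcomplex_row_linear|exact: Rcomplex_row_bij]. Qed.

HB.instance Definition _ := Lmodule_hasFinDim.Build R CR Rcomplex_vector.

Definition complexR : falgType R := CR.

Definition conjR : {lrmorphism complexR -> complexR} :=
  @conjc R : {lrmorphism CR -> CR}.

Lemma conjR_sq (s : bool) (d : complexR) :
  conjR (conjR d) = (-1) ^+ s * d * ((-1) ^+ s)^-1.
Proof. by rewrite -sign_comm; exact: conjcK. Qed.

Lemma conjR_sign (s : bool) : conjR ((-1) ^+ s) = (-1) ^+ s.
Proof. by rewrite rmorphXn rmorphN1. Qed.

(* (C, conj, (-1)^s) *)
Definition conjData (s : bool) : crossedData R :=
  @CrossedData R complexR conjR ((-1) ^+ s) (sign_unit _ s) (conjR_sq s)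
    (conjR_sign s).

(* H = C + C j with j^2 = -1 and j z = conj(z) j.                             *)
Definition quaternions : falgType R := crossed (conjData true).

End RealAlgebras.

Section Classification.
Variables (K : fieldType) (N : nat).
Local Notation Z2N := 'rV['F_2]_N.
Variable z : N.-tuple Z2N.

Definition square_one_gens (D : gradedAlg K Z2N) (theta : 'I_N -> D) : Prop :=
  forall i, [/\ theta i \in gcomp D (tnth z i), commutes_with0 (theta i)
              & theta i ^+ 2 = 1].

Definition square_sign_gens (D : gradedAlg K Z2N) (theta : 'I_N -> D) : Prop :=
  forall i, [/\ theta i \in gcomp D (tnth z i), commutes_with0 (theta i)
              & theta i ^+ 2 = 1 \/ theta i ^+ 2 = -1].

(* The index 0 plays the role of the distinguished first basis vector.        *)
Definition conj_gens (D : gradedAlg K Z2N) (theta : 'I_N -> D) : Prop :=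
  forall i : 'I_N, theta i \in gcomp D (tnth z i) /\
    (if i == 0%N :> nat then theta i ^+ 2 = 1 \/ theta i ^+ 2 = -1
     else theta i ^+ 2 = 1).

Definition products_square_to_signs (D : gradedAlg K Z2N)
    (theta : 'I_N -> D) : Prop :=
  forall i j, i != j ->
    (theta i * theta j) ^+ 2 = 1 \/ (theta i * theta j) ^+ 2 = -1.

(* The sign a_ij is encoded by the boolean a i j, for i < j only.             *)
Definition has_signs (D : gradedAlg K Z2N) (theta : 'I_N -> D)
    (a : 'I_N -> 'I_N -> bool) : Prop :=
  forall i j : 'I_N, (i < j)%N -> (theta i * theta j) ^+ 2 = (-1) ^+ a i j.

Definition has_normal_form (P : gradedAlg K Z2N -> Prop)
    (gens : forall D : gradedAlg K Z2N, ('I_N -> D) -> Prop)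
    (allowed : 'I_N -> gradedAlg K 'F_2 -> Prop) : Prop :=
  forall D : gradedAlg K Z2N, P D ->
    [/\ exists theta : 'I_N -> D, gens D theta,
        forall theta : 'I_N -> D, gens D theta -> products_square_to_signs theta
      & forall i, allowed i (Z2sub D (tnth z i))].

(* The algebras satisfying P are classified by ({D_i}, {a_ij}_{i<j}), where   *)
(* the a_ij are computed from any generators satisfying gens, D_i ranges over *)
(* the Z_2-graded algebras satisfying allowed i, and a_ij over all signs.     *)
Definition classified_by (P : gradedAlg K Z2N -> Prop)
    (gens : forall D : gradedAlg K Z2N, ('I_N -> D) -> Prop)
    (allowed : 'I_N -> gradedAlg K 'F_2 -> Prop) : Prop :=
  (forall (D D' : gradedAlg K Z2N) (theta : 'I_N -> D) (theta' : 'I_N -> D')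
      (a a' : 'I_N -> 'I_N -> bool),
      P D -> P D' -> gens D theta -> gens D' theta' ->
      has_signs theta a -> has_signs theta' a' ->
      (graded_iso D D' <->
         (forall i, graded_iso (Z2sub D (tnth z i)) (Z2sub D' (tnth z i))) /\
         (forall i j : 'I_N, (i < j)%N -> a i j = a' i j)))
  /\
  (forall (E : 'I_N -> gradedAlg K 'F_2) (a : 'I_N -> 'I_N -> bool),
      (forall i, allowed i (E i)) ->
      exists (D : gradedAlg K Z2N) (theta : 'I_N -> D),
        [/\ P D, gens D theta, has_signs theta a
          & forall i, graded_iso (Z2sub D (tnth z i)) (E i)]).

End Classification.

(* Index 0 is z_1. Only phi and its composite with conjR identify C with D_0, *)
(* so the condition does not depend on the choice of phi.                     *)
Definition adapted (R : realType) (N : nat) (D : gradedAlg R 'rV['F_2]_N)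
    (z : N.-tuple 'rV['F_2]_N) : Prop :=
  exists phi : {lrmorphism complexR R -> D}, identifies0 phi /\
    forall (i : 'I_N) (x : D), x \in gcomp D (tnth z i) -> x != 0 ->
      forall d, x * phi d * x^-1 = phi (if i == 0%N :> nat then conjR R d else d).

(* Main.v *)
Require Import Defs.
From HB Require Import structures.
From mathcomp Require Import all_boot all_order all_algebra all_field.
From mathcomp Require Import reals complex.

Set Implicit Arguments.
Unset Strict Implicit.
Unset Printing Implicit Defensive.

Import Order.TTheory GRing.Theory Num.Theory.
Local Open Scope ring_scope.

(** Each nonzero component is D_c = D_0 X_c for a single X_c. Normalised
    generators theta_i of the D_(z_i) commute up to sign, so the ordered products
    X_c = prod_i theta_i^(c_i) satisfy X_a X_b = (-1)^q(a,b) X_(a+b), where the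
    biadditive form q only depends on the signs theta_i^2 and a_ij. Hence D is the
    twisted group algebra of (Z/2)^N over D_0 attached to q, which gives both
    uniqueness and existence. Two choices of generators differ by factors y_i in
    the centre of D_0 that are unitary (y_i sigma_i(y_i) = 1, with sigma_i the
    action of theta_i on D_0), and these do not change (theta_i theta_j)^2.

    Generators are obtained as follows: D_0 = C when K = C since left
    multiplication by an element of D_0 has an eigenvalue; for D_0 = H averaging
    over i and j yields an element commuting with D_0; squares are then normalised
    by a square root. *)

(** * Graded isomorphisms *)

(** All four cases are instances of one theorem with parameters: a model [B] of D_0, an involution
    [tau] through which the first generator may act, and the signs allowed as squares. The
    arithmetic special to a case is reduced to two statements about the twisted norm y sigma_i(y) of
    central y in D_0: a norm can turn every admissible square into an allowed sign, and a norm
    carrying one allowed sign to another equals 1. The second holds because y^2 (y real) and y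
    conj(y) are nonnegative, or because only the sign +1 is allowed. This is what keeps a_ij
    invariant in case (4), where theta_1 may be multiplied by any complex number of modulus 1 while
    the other generators only change by a sign. Biadditivity of q is stronger than the cocycle
    condition; it holds because reordering a product of generators produces an exponent bilinear in
    the two exponent vectors. Realising prescribed data then amounts to prescribing q on pairs of
    basis vectors. *)

Lemma lrmorphism_exists (K : fieldType) (A B : falgType K) (f : A -> B) :
  linear f -> f 1 = 1 -> {morph f : x y / x * y} ->
  exists g : {lrmorphism A -> B}, g =1 f.
Proof.
move=> f_lin f1 fM.
pose mlin := GRing.isLinear.Build K A B *:%R f f_lin.
pose mmul := GRing.isMonoidMorphism.Build A B f (f1, fM).
pose F : {lrmorphism A -> B} := HB.pack f mlin mmul.
by exists F.
Qed.

Lemma lrmorphism_inv (K : fieldType) (A B : falgType K)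
    (f : {lrmorphism A -> B}) : bijective f ->
  exists2 g : {lrmorphism B -> A}, cancel f g & cancel g f.
Proof.
case=> g0 fK gK; have f_inj := can_inj fK.
have [g gE] : exists g : {lrmorphism B -> A}, g =1 g0.
  apply: lrmorphism_exists => [k u v||u v]; apply: f_inj.
  - by rewrite gK linearP /= !gK.
  - by rewrite gK rmorph1.
  - by rewrite gK rmorphM /= !gK.
by exists g => x; rewrite gE.
Qed.

Section GradedIso.
Variables (K : fieldType) (G : finZmodType).
Implicit Types A B C : gradedAlg K G.

Lemma graded_sum0 A (u : G -> A) : (forall c, u c \in gcomp A c) ->
  \sum_c u c = 0 -> forall c, u c = 0.
Proof.
move=> uA u0 c; have /directv_sum_independent := gcomp_direct A.
by apply=> // i _; apply: uA.
Qed.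

Lemma graded_decomp A (x : A) :
  exists2 u : G -> A, forall c, u c \in gcomp A c & x = \sum_c u c.
Proof.
have : x \in (\sum_c gcomp A c)%VS by rewrite gcomp_full memvf.
by case/memv_sumP=> u uA ->; exists u => // c; apply: uA.
Qed.

(** Degrees are only assumed to be preserved in one direction. For y in B_c, the images of the
    components of g y are homogeneous and sum to y, so all of them outside degree c vanish. *)
Lemma graded_iso_inv A B (f : {lrmorphism A -> B}) : is_graded_iso f ->
  exists g : {lrmorphism B -> A}, [/\ is_graded_iso g, cancel f g & cancel g f].
Proof.
case=> f_bij fA; have [g fK gK] := lrmorphism_inv f_bij.
exists g; split=> //; split=> [|c y By]; first by exists f.
have [u uA gy] := graded_decomp (g y).
have u0 e : e != c -> u e = 0.
  move=> ec; apply: (can_inj fK); rewrite rmorph0.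
  (* The components of f (g y) minus those of y: homogeneous elements with sum 0. *)
  pose v e := f (u e) - (if e == c then y else 0).
  have vB e' : v e' \in gcomp B e'.
    rewrite memvB ?fA //; case: eqP => [->//|_]; exact: mem0v.
  have fu : \sum_e' f (u e') = y by rewrite -[RHS]gK gy rmorph_sum.
  have /(graded_sum0 vB)/(_ e) : \sum_e' v e' = 0.
    by rewrite sumrB fu -big_mkcond big_pred1_eq subrr.
  by rewrite /v (negPf ec) subr0.
rewrite gy (bigD1 c) //= big1 ?addr0 //.
Qed.

Lemma graded_iso_sym A B : graded_iso A B -> graded_iso B A.
Proof. by case=> f /graded_iso_inv[g [g_iso _ _]]; exists g. Qed.

Lemma graded_iso_trans A B C : graded_iso A B -> graded_iso B C -> graded_iso A C.
Proof.
case=> f [f_bij fA] [g [g_bij gB]].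
exists (g \o f : {lrmorphism A -> C}); split=> [|c x Ax]; first exact: bij_comp.
by rewrite /= gB ?fA.
Qed.

Lemma graded_iso_mem A B (f : {lrmorphism A -> B}) c x :
  is_graded_iso f -> (f x \in gcomp B c) = (x \in gcomp A c).
Proof.
move=> f_iso; apply/idP/idP; last by case: f_iso => _; apply.
by have [g [[_ gB] fK _]] := graded_iso_inv f_iso => /gB; rewrite fK.
Qed.

End GradedIso.

(** * Twisted group algebras *)

(** In every case the group acts on D_0 through the identity and one involution, so a character to
    Z/2 encodes the action. Sign exponents are booleans, with [(+)] as their addition. *)
Record twist (K : fieldType) (G : finZmodType) (B : falgType K) := Twist {
  tw_aut : {lrmorphism B -> B};
  tw_chi : G -> bool;
  tw_q : G -> G -> bool;
  tw_autK : involutive tw_aut;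
  tw_chiD : {morph tw_chi : a b / a + b >-> a (+) b};
  tw_qDl : forall c, {morph tw_q^~ c : a b / a + b >-> a (+) b};
  tw_qDr : forall c, {morph tw_q c : a b / a + b >-> a (+) b}
}.

(* u stands for the sum of the u(a) X_a, where X_a d = tw_act a (d) X_a and    *)
(* X_a X_b = (-1)^q(a,b) X_(a+b); a biadditive q is a 2-cocycle.               *)
Definition twisted (K : fieldType) (G : finZmodType) (B : falgType K)
  (W : twist G B) : Type := {ffun G -> B}.

Section Twisted.
Variables (K : fieldType) (G : finZmodType) (B : falgType K) (W : twist G B).
Local Notation q := (tw_q W).
Local Notation M := (twisted W).
Implicit Types (u v w : M) (a b c : G) (x y : B).

Definition tw_act a : {lrmorphism B -> B} := if tw_chi W a then tw_aut W else idfun.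

Lemma tw_chi0 : tw_chi W 0 = false.
Proof. by have := tw_chiD W 0 0; rewrite addr0 addbb. Qed.

Lemma tw_q0l a : q 0 a = false.
Proof. by have := tw_qDl W a 0 0; rewrite addr0 addbb. Qed.

Lemma tw_q0r a : q a 0 = false.
Proof. by have := tw_qDr W a 0 0; rewrite addr0 addbb. Qed.

Lemma tw_act0 x : tw_act 0 x = x.
Proof. by rewrite /tw_act tw_chi0. Qed.

Lemma tw_actD a b x : tw_act (a + b) x = tw_act a (tw_act b x).
Proof.
rewrite /tw_act tw_chiD; case: (tw_chi W a); case: (tw_chi W b) => //=.
by rewrite tw_autK.
Qed.

Lemma tw_actZ a k x : tw_act a (k *: x) = k *: tw_act a x.
Proof. exact: linearZ. Qed.

HB.instance Definition _ := Vector.copy M {ffun G -> B}.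

Definition tw_elt c x : M := [ffun a => if a == c then x else 0].

Definition tw_mul u v : M :=
  [ffun c => \sum_a (-1) ^+ q a (c - a) *: (u a * tw_act a (v (c - a)))].

(** For factors of degrees b, a, e, biadditivity turns both q(b, a+e) + q(a, e) and q(b, a) + q(b+a,
    e) into q(b, a) + q(b, e) + q(a, e). The signs are scalars of K, so the action fixes them. *)
Lemma tw_mulA : associative tw_mul.
Proof.
move=> u v w; apply/ffunP => c; rewrite !ffunE.
transitivity (\sum_b \sum_a (-1) ^+ (q b a (+) q b (c - (b + a)) (+) q a (c - (b + a)))
   *: (u b * tw_act b (v a) * tw_act (b + a) (w (c - (b + a))))).
  apply: eq_bigr => b _; rewrite ffunE linear_sum /= mulr_sumr scaler_sumr.
  apply: eq_bigr => a _; rewrite -addrA -opprD tw_actZ -scalerAr scalerA.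
  rewrite -signr_addb rmorphM /= tw_actD !mulrA; congr (_ ^+ _ *: _).
  by rewrite -tw_qDr opprD addrA addrCA subrr addr0.
rewrite exchange_big /= [RHS](eq_bigr (fun e => \sum_b
   (-1) ^+ (q b (e - b) (+) q e (c - e)) *:
     (u b * tw_act b (v (e - b)) * tw_act e (w (c - e))))); last first.
  move=> e _; rewrite ffunE mulr_suml scaler_sumr; apply: eq_bigr => b _.
  by rewrite -scalerAl scalerA -signr_addb addbC.
rewrite exchange_big [RHS]exchange_big /=; apply: eq_bigr => b _.
rewrite [RHS](reindex_inj (addrI b)) /=; apply: eq_bigr => a _.
by rewrite tw_qDl addrAC subrr add0r addbA.
Qed.

Lemma tw_mulDl : left_distributive tw_mul +%R.
Proof.
move=> u v w; apply/ffunP => c; rewrite !ffunE -big_split; apply: eq_bigr => a _.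
by rewrite !ffunE mulrDl scalerDr.
Qed.

Lemma tw_mulDr : right_distributive tw_mul +%R.
Proof.
move=> u v w; apply/ffunP => c; rewrite !ffunE -big_split; apply: eq_bigr => a _.
by rewrite !ffunE rmorphD mulrDr scalerDr.
Qed.

Lemma tw_scaleAl k u v : k *: (tw_mul u v) = tw_mul (k *: u) v.
Proof.
apply/ffunP => c; rewrite !ffunE scaler_sumr; apply: eq_bigr => a _.
by rewrite !ffunE -scalerAl !scalerA mulrC.
Qed.

Lemma tw_scaleAr k u v : k *: (tw_mul u v) = tw_mul u (k *: v).
Proof.
apply/ffunP => c; rewrite !ffunE scaler_sumr; apply: eq_bigr => a _.
by rewrite !ffunE tw_actZ -scalerAr !scalerA mulrC.
Qed.

Lemma tw_mul_elt a b x y : tw_mul (tw_elt a x) (tw_elt b y) =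
  (-1) ^+ q a b *: tw_elt (a + b) (x * tw_act a y).
Proof.
apply/ffunP => c; rewrite !ffunE (bigD1 a) //= big1 => [|e /negPf ea]; last first.
  by rewrite !ffunE ea mul0r scaler0.
rewrite !ffunE eqxx addr0 subr_eq [b + a]addrC.
case: eqP => [->|_]; last by rewrite rmorph0 mulr0 !scaler0.
by rewrite addrAC subrr add0r.
Qed.

Lemma tw_elt_linear c : linear (tw_elt c).
Proof.
by move=> k x y; apply/ffunP=> a; rewrite !ffunE; case: eqP; rewrite ?scaler0 ?addr0.
Qed.

HB.instance Definition _ c :=
  GRing.isLinear.Build K B M *:%R (tw_elt c) (tw_elt_linear c).

Lemma tw_sum u : u = \sum_c tw_elt c (u c).
Proof.
apply/ffunP => a; rewrite sum_ffunE (bigD1 a) //= big1 => [|c ca].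
  by rewrite ffunE eqxx addr0.
by rewrite ffunE eq_sym (negPf ca).
Qed.

Lemma tw_mul1l : left_id (tw_elt 0 1) tw_mul.
Proof.
move=> u; apply/ffunP => c; rewrite ffunE (bigD1 0) //= big1 => [|a /negPf a0].
  by rewrite ffunE eqxx tw_q0l scale1r tw_act0 mul1r subr0 addr0.
by rewrite ffunE a0 mul0r scaler0.
Qed.

Lemma tw_mul1r : right_id (tw_elt 0 1) tw_mul.
Proof.
move=> u; apply/ffunP => c; rewrite ffunE (bigD1 c) //= big1 => [|a /negPf ac].
  by rewrite ffunE subrr eqxx tw_q0r scale1r rmorph1 mulr1 addr0.
by rewrite ffunE subr_eq0 eq_sym ac rmorph0 mulr0 scaler0.
Qed.

Lemma tw_1neq0 : tw_elt 0 1 != 0.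
Proof. by apply/eqP => /ffunP/(_ 0)/eqP; rewrite !ffunE eqxx oner_eq0. Qed.

HB.instance Definition _ := GRing.Zmodule_isNzRing.Build M
  tw_mulA tw_mul1l tw_mul1r tw_mulDl tw_mulDr tw_1neq0.
HB.instance Definition _ := GRing.Lmodule_isLalgebra.Build K M tw_scaleAl.
HB.instance Definition _ := GRing.Lalgebra_isAlgebra.Build K M tw_scaleAr.
HB.instance Definition _ := Algebra_isFalgebra.Build K M.

Definition tw_comp c : {vspace M} := limg (linfun (tw_elt c)).

Lemma mem_tw_elt c x : tw_elt c x \in tw_comp c.
Proof. by rewrite -[tw_elt c x](lfunE (tw_elt c)) memv_img ?memvf. Qed.

Lemma tw_compP c u : u \in tw_comp c -> u = tw_elt c (u c).
Proof. by case/memv_imgP => x _ ->; rewrite lfunE /= ffunE eqxx. Qed.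

Lemma tw_comp_direct : directv (\sum_c tw_comp c)%VS.
Proof.
apply/directv_sum_independent => us us_in us0 c _.
rewrite (tw_compP (us_in c isT)).
have /ffunP/(_ c) := us0; rewrite sum_ffunE (bigD1 c) //= big1 => [|a ac].
  by rewrite addr0 => ->; rewrite ffunE linear0.
by rewrite (tw_compP (us_in a isT)) ffunE eq_sym (negPf ac).
Qed.

Lemma tw_comp_full : (\sum_c tw_comp c = fullv)%VS.
Proof.
apply/eqP; rewrite eqEsubv subvf; apply/subvP => u _; rewrite (tw_sum u).
by apply: memv_sumr => c _; apply: mem_tw_elt.
Qed.

Lemma tw_compM a b u v :
  u \in tw_comp a -> v \in tw_comp b -> u * v \in tw_comp (a + b).
Proof.
by move=> /tw_compP-> /tw_compP->; rewrite [_ * _]tw_mul_elt memvZ ?mem_tw_elt.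
Qed.

Definition twisted_graded : gradedAlg K G :=
  GradedAlg tw_comp_direct tw_comp_full (mem_tw_elt 0 1) tw_compM.

Lemma twisted_full_division : (forall x, x != 0 -> x \is a GRing.unit) ->
  (forall c : G, c + c = 0) -> full_division_alg twisted_graded.
Proof.
move=> Bdiv G2; split=> [c u|c]; last first.
  apply/eqP => c0; have := mem_tw_elt c 1.
  rewrite [tw_comp c]c0 memv0 => /eqP/ffunP/(_ c)/eqP.
  by rewrite !ffunE eqxx oner_eq0.
move=> /tw_compP-> u0; set x := u c in u0 *.
have x0 : x != 0 by apply: contra_neq u0 => ->; rewrite linear0.
have Ux := Bdiv _ x0; apply/unitrP.
(* Since c + c = 0, X_c is its own inverse up to the sign (-1)^q(c,c), and X_c x^-1 is
   [tw_act c x^-1] times X_c. *)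
exists ((-1) ^+ q c c *: tw_elt c (tw_act c x^-1)).
have E (y z : B) : tw_elt c y * tw_elt c z = (-1) ^+ q c c *: tw_elt 0 (y * tw_act c z).
  by rewrite [LHS]tw_mul_elt G2.
rewrite -scalerAl -scalerAr !E !scalerA -expr2 sqrr_sign !scale1r -tw_actD G2 tw_act0.
by rewrite -rmorphM /= mulVr // mulrV // rmorph1.
Qed.

End Twisted.

(** The relations of the twisted group algebra, read inside a given D. When c + c = 0 they make
    X_c^2 a sign, hence X_c invertible, and this already forces D_c = D_0 X_c. *)
Record twisted_basis (K : fieldType) (G : finZmodType) (B : falgType K)
    (W : twist G B) (D : gradedAlg K G) (phi : {lrmorphism B -> D}) (X : G -> D) :
    Prop := TwistedBasis {
  tb_id : identifies0 phi;
  tb_mem : forall c, X c \in gcomp D c;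
  tb_one : X 0 = 1;
  tb_comm : forall a x, X a * phi x = phi (tw_act W a x) * X a;
  tb_mul : forall a b, X a * X b = (-1) ^+ tw_q W a b *: X (a + b)
}.

Section TwistedBasis.
Variables (K : fieldType) (G : finZmodType) (B : falgType K) (W : twist G B).
Hypothesis G2 : forall c : G, c + c = 0.

Lemma identifies0_mem (D : gradedAlg K G) (phi : {lrmorphism B -> D}) x :
  identifies0 phi -> phi x \in gcomp D 0.
Proof. by case=> _ D0; apply/D0; exists x. Qed.

Section Basis.
Variables (D : gradedAlg K G) (phi : {lrmorphism B -> D}) (X : G -> D).
Hypothesis XW : twisted_basis W phi X.

Lemma tb_sqr c : X c * X c = (-1) ^+ tw_q W c c *: 1.
Proof. by rewrite (tb_mul XW) G2 (tb_one XW). Qed.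

Lemma tb_memM c x : phi x * X c \in gcomp D c.
Proof.
rewrite -[c]add0r gcompM ?add0r ?(tb_mem XW) // identifies0_mem //.
exact: tb_id XW.
Qed.

Lemma tb_homog c x : x \in gcomp D c -> exists d, x = phi d * X c.
Proof.
move=> Dx; have [_ D0] := tb_id XW.
have : (-1) ^+ tw_q W c c *: (x * X c) \in gcomp D 0.
  by rewrite memvZ // -(G2 c) gcompM ?(tb_mem XW).
case/D0=> d dE; exists d.
by rewrite dE -scalerAl -mulrA tb_sqr -scalerAr scalerA -expr2 sqrr_sign scale1r mulr1.
Qed.

Lemma tb_inj c x : phi x * X c = 0 -> x = 0.
Proof.
move=> /(congr1 (fun y => y * X c)); rewrite mul0r -mulrA tb_sqr -scalerAr mulr1.
move/(congr1 (fun y => (-1) ^+ tw_q W c c *: y)).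
rewrite scalerA -expr2 sqrr_sign scale1r scaler0 => phix0.
by have [phi_inj _] := tb_id XW; apply: phi_inj; rewrite rmorph0.
Qed.

Lemma twisted_iso : graded_iso (twisted_graded W) D.
Proof.
pose f (u : twisted W) : D := \sum_c phi (u c) * X c.
have f_elt c x : f (tw_elt W c x) = phi x * X c.
  rewrite /f (bigD1 c) //= big1 ?ffunE ?eqxx ?addr0 // => a /negPf ac.
  by rewrite ffunE ac rmorph0 mul0r.
have [F fE] : exists F : {lrmorphism twisted_graded W -> D}, F =1 f.
  apply: lrmorphism_exists => [k u v||u v].
  - rewrite /f scaler_sumr -big_split; apply: eq_bigr => c _.
    by rewrite !ffunE linearP /= mulrDl -scalerAl.
  - by rewrite f_elt rmorph1 (tb_one XW) mulr1.
  rewrite /f mulr_suml.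
  transitivity (\sum_c \sum_a phi ((-1) ^+ tw_q W a (c - a) *:
    (u a * tw_act W a (v (c - a)))) * X c).
    by apply: eq_bigr => c _; rewrite ffunE linear_sum mulr_suml.
  rewrite exchange_big; apply: eq_bigr => a _ /=.
  rewrite mulr_sumr (reindex_inj (addrI a)); apply: eq_bigr => b _ /=.
  rewrite addrAC subrr add0r mulrA -[_ * X a * _]mulrA (tb_comm XW) !mulrA.
  by rewrite -mulrA (tb_mul XW) -scalerAr linearZ /= -scalerAl rmorphM.
have F_elt c x : F (tw_elt W c x) = phi x * X c by rewrite fE.
exists F; split=> [|c u Du]; last first.
  by rewrite (tw_compP Du) F_elt tb_memM.
have F_inj : injective F.
  move=> u v; rewrite !fE => uv; apply/ffunP => c; apply/eqP; rewrite -subr_eq0.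
  apply/eqP; apply: (@tb_inj c); rewrite rmorphB mulrBl.
  have : \sum_c (phi (u c) * X c - phi (v c) * X c) = 0.
    by rewrite sumrB; apply/eqP; rewrite subr_eq0; apply/eqP.
  by move/graded_sum0; apply => a; rewrite memvB ?tb_memM.
have F_surj y : exists u, F u == y.
  have [z zD ->] := graded_decomp y.
  have [w wE] : exists w : {ffun G -> B}, forall c, z c = phi (w c) * X c.
    have [w wE] : exists w : G -> B, forall c, z c = phi (w c) * X c.
      apply: (@fin_all_exists _ _ (fun c d => z c = phi d * X c)) => c.
      exact: tb_homog.
    by exists (finfun w) => c; rewrite ffunE.
  by exists w; rewrite fE; apply/eqP/eq_bigr => c _; rewrite wE.
exists (fun y => xchoose (F_surj y)) => [u|y].
  by apply: F_inj; apply/eqP/(xchooseP (F_surj _)).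
exact/eqP/(xchooseP (F_surj _)).
Qed.

End Basis.

Lemma twisted_basis_iso (D D' : gradedAlg K G) (phi : {lrmorphism B -> D})
    (phi' : {lrmorphism B -> D'}) (X : G -> D) (X' : G -> D') :
  twisted_basis W phi X -> twisted_basis W phi' X' -> graded_iso D D'.
Proof.
move=> /twisted_iso DW /twisted_iso.
exact: graded_iso_trans (graded_iso_sym DW).
Qed.

Lemma twisted_has_basis :
  exists phi : {lrmorphism B -> twisted_graded W},
    twisted_basis W phi (fun c => tw_elt W c 1).
Proof.
have E a b x y : tw_elt W a x * tw_elt W b y =
    (-1) ^+ tw_q W a b *: tw_elt W (a + b) (x * tw_act W a y).
  exact: tw_mul_elt.
have [phi phiE] : exists phi : {lrmorphism B -> twisted_graded W},
    phi =1 tw_elt W 0.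
  apply: lrmorphism_exists => //; first exact: tw_elt_linear.
  by move=> x y; rewrite E tw_q0l scale1r addr0 tw_act0.
exists phi; split=> [|c|//|a x|a b]; last 2 first.
- by rewrite !phiE !E tw_q0l tw_q0r addr0 add0r !scale1r mul1r rmorph1 mulr1.
- by rewrite E rmorph1 mulr1.
- split=> [x y|u].
    by rewrite !phiE => /ffunP/(_ 0); rewrite !ffunE eqxx.
  split=> [/tw_compP ->|[x <-]]; first by exists (u 0); rewrite phiE.
  by rewrite phiE mem_tw_elt.
exact: mem_tw_elt.
Qed.

End TwistedBasis.

(** * Crossed products *)

Section Z2subCrossed.
Variables (K : fieldType) (N : nat) (D : gradedAlg K 'rV['F_2]_N).
Variables (c : 'rV['F_2]_N) (d : crossedData K).
Variables (phi : {lrmorphism cr_base d -> D}) (theta : D).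
Hypotheses (phi0 : identifies0 phi) (c_neq0 : c != 0) (theta_c : theta \in gcomp D c).
Hypothesis theta_comm : forall x, theta * phi x = phi (cr_aut d x) * theta.
Hypothesis theta_sq : theta ^+ 2 = phi (cr_sq d).

(** The map x + y theta from the crossed product is shown to be bijective and then inverted. The
    last clause says that the inverse restricts to the inverse of [phi] on D_0, from which
    C-linearity is obtained in case (3). *)
Lemma Z2sub_crossed : exists f : {lrmorphism Z2sub D c -> crossed_graded d},
  is_graded_iso f /\
  forall w x, Z2sub_val w = phi x -> f w = crossed_in d x.
Proof.
pose g0 (u : crossed d) : D := phi (crossed_fst u) + phi (crossed_snd u) * theta.
have sE x : phi x \in Z2sub_space D c.
  by apply: (subvP (addvSl _ _)); apply: identifies0_mem.
have sO x : phi x * theta \in Z2sub_odd D c.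
  rewrite /Z2sub_odd (negPf c_neq0) -[c]add0r gcompM ?add0r //.
  exact: identifies0_mem.
have g0_in u : g0 u \in Z2sub_aspace D c.
  by rewrite memvD ?sE // (subvP (addvSr _ _)).
pose g u : Z2sub D c := Subvs (g0_in u).
have gE u : Z2sub_val (g u) = g0 u by [].
have [G GE] : exists G : {lrmorphism crossed_graded d -> Z2sub D c}, G =1 g.
  apply: lrmorphism_exists => [k u v||u v]; apply: val_inj => /=.
  - rewrite /g0 /= !linearP /= mulrDl -scalerAl scalerDr -!addrA; congr (_ + _).
    by rewrite addrCA.
  - rewrite /g0 /= rmorph0 mul0r addr0 rmorph1.
    have /eqP one : algid (Z2sub_aspace D c) == 1 by rewrite algid_eq1 Z2sub_one.
    exact: esym one.
  rewrite /g0 /= !(mulrDl, mulrDr) !rmorphD !rmorphM /= mulrDl !mulrA.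
  rewrite -[_ * theta * phi (crossed_fst v)]mulrA theta_comm.
  rewrite -[_ * theta * phi (crossed_snd v)]mulrA theta_comm !mulrA.
  rewrite -[_ * theta * theta]mulrA -expr2 theta_sq.
  by rewrite addrACA [X in _ = _ + X]addrC.
have theta_inv : phi (cr_sq d)^-1 * theta * theta = 1.
  by rewrite -mulrA -expr2 theta_sq -rmorphM mulVr ?rmorph1 ?cr_sq_unit.
have thetaV : theta * phi (cr_sq d)^-1 * theta = 1.
  by rewrite theta_comm rmorphV ?cr_sq_unit //= cr_aut_sq theta_inv.
have [phi_inj D0] := phi0.
have G_inj : injective G.
  have sub0 u : g0 u = 0 -> u = 0.
    move=> u0; have : phi (crossed_fst u) \in (gcomp D 0 :&: Z2sub_odd D c)%VS.
      rewrite memv_cap identifies0_mem //.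
      by move/eqP: u0; rewrite addr_eq0 => /eqP->; rewrite memvN sO.
    rewrite Z2sub_cap memv0 => /eqP phiu0; have := u0; rewrite /g0 phiu0 add0r.
    move/(congr1 ( *%R^~ theta)); rewrite mul0r -mulrA -expr2 theta_sq.
    rewrite -rmorphM => /eqP; rewrite -(rmorph0 phi) (inj_eq phi_inj).
    move/eqP/(congr1 ( *%R^~ (cr_sq d)^-1)); rewrite mulrK ?cr_sq_unit // mul0r.
    move=> snd0; apply: crossed_eq => //=.
    by apply: phi_inj; rewrite phiu0 rmorph0.
  move=> u v uv; apply/eqP; rewrite -subr_eq0; apply/eqP/sub0.
  have : G (u - v) = 0 by rewrite rmorphB /= uv subrr.
  by rewrite GE => /(congr1 (@Z2sub_val _ _ _ _)).
have G_surj w : exists u, G u == w.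
  have /memv_addP[x0 /D0[y0 <-] [x1 Dx1 wE]] := subvsP w.
  have : x1 * theta \in gcomp D 0.
    rewrite -(F2_addrr c) gcompM //.
    by move: Dx1; rewrite /Z2sub_odd (negPf c_neq0).
  case/D0 => y1 y1E.
  (* The odd part is x1 = (x1 theta) theta^-1 with theta^-1 = a^-1 theta, where a = theta^2; hence
     the coefficient y1 a^-1. *)
  exists (Crossed y0 (y1 * (cr_sq d)^-1)); rewrite GE; apply/eqP/val_inj => /=.
  rewrite wE /g0 /= rmorphM /= y1E; congr (_ + _).
  by rewrite -!mulrA [theta * _]mulrA thetaV mulr1.
pose h w := xchoose (G_surj w).
have hK : cancel h G by move=> w; apply/eqP/(xchooseP (G_surj w)).
have G_iso : is_graded_iso G.
  split; first by exists h => // u; apply: G_inj; rewrite hK.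
  move=> b u; rewrite /= /Z2comp GE; case: eqP => _.
    rewrite mem_crossed_even mem_Z2sub_part /= /g0 => /eqP->.
    by rewrite rmorph0 mul0r addr0 identifies0_mem.
  rewrite mem_crossed_odd mem_Z2sub_part /= /g0 => /eqP->.
  by rewrite rmorph0 add0r.
have [f [f_iso GK _]] := graded_iso_inv G_iso.
exists f; split=> // w x wx; rewrite -[RHS]GK; congr (f _).
by apply: val_inj; rewrite GE /= /g0 /= rmorph0 mul0r addr0.
Qed.

End Z2subCrossed.

(** An isomorphism sends theta to some y theta'; comparing squares gives the norm equation. If theta
    and theta' both centralise D_0, then so does y. *)
Lemma crossed_iso_sq (K : fieldType) (d d' : crossedData K) (s : bool) :
  graded_iso (crossed_graded d) (crossed_graded d') -> cr_sq d = (-1) ^+ s ->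
  exists2 y : cr_base d', y * cr_aut d' y * cr_sq d' = (-1) ^+ s
    & (forall x, cr_aut d x = x) -> (forall x, cr_aut d' x = x) ->
      forall x, x * y = y * x.
Proof.
case=> f f_iso ds.
have [g [[_ g_even] _ gK]] := graded_iso_inv f_iso.
have f_even x : exists x', f (crossed_in d x') = crossed_in d' x.
  have : crossed_in d' x \in gcomp (crossed_graded d') 0.
    by rewrite /= /Z2comp mem_crossed_even.
  move/g_even; rewrite /= /Z2comp mem_crossed_even => /eqP gx.
  exists (crossed_fst (g (crossed_in d' x))); rewrite -[RHS]gK; congr (f _).
  exact: crossed_eq.
pose th : crossed_graded d := Crossed 0 1 : crossed d.
have [y fy] : exists y, f th = Crossed 0 y.
  have : f th \in gcomp (crossed_graded d') 1.
    by rewrite (graded_iso_mem _ _ f_iso) /= /Z2comp mem_crossed_odd.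
  rewrite /= /Z2comp mem_crossed_odd => /eqP fx.
  by exists (crossed_snd (f th)); apply: crossed_eq.
have in_sign (e : crossedData K) : crossed_in e ((-1) ^+ s) = (-1) ^+ s.
  by case: s {ds}; apply: crossed_eq; rewrite /= ?oppr0.
exists y => [|aut1 aut1' x].
  have th2 : th * th = (-1) ^+ s.
    rewrite -[RHS](in_sign d) -ds.
    by apply: crossed_eq; rewrite /= ?rmorph1 ?rmorph0
      !(mul0r, mul1r, mulr0, add0r, addr0).
  have : f th * f th = (-1) ^+ s by rewrite -rmorphM th2 rmorph_sign.
  rewrite fy -[RHS](in_sign d').
  by move/(congr1 (@crossed_fst _ _)); rewrite /= mul0r add0r.
have [x' fx] := f_even x.
have : crossed_in d x' * th = th * crossed_in d x'.
  by apply: crossed_eq; rewrite /= ?aut1 ?rmorph0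
    !(mul0r, mul1r, mulr0, mulr1, add0r, addr0).
move/(congr1 f); rewrite !rmorphM /= fx fy => /(congr1 (@crossed_snd _ _)) /=.
by rewrite !aut1' !mul0r add0r addr0.
Qed.

(** * Generators indexed by a basis *)

Lemma F2_neq0D (x y : 'F_2) : (x + y != 0) = (x != 0) (+) (y != 0).
Proof. by case: x y => [[|[|k]]] // ? [[|[|l]]]. Qed.

Section Coordinates.
Variables (N : nat) (z : N.-tuple 'rV['F_2]_N).
Hypothesis z_basis : basis_of fullv z.

Definition zcoord (c : 'rV['F_2]_N) (i : 'I_N) : bool := coord z i c != 0.

Lemma zcoordD a b i : zcoord (a + b) i = zcoord a i (+) zcoord b i.
Proof. by rewrite /zcoord linearD F2_neq0D. Qed.

Lemma zcoord_basis i j : zcoord (tnth z i) j = (i == j).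
Proof.
rewrite /zcoord (tnth_nth 0) coord_free ?(basis_free z_basis) //.
by case: (i == j).
Qed.

Lemma zcoord_sum c : c = \sum_i (if zcoord c i then tnth z i else 0).
Proof.
rewrite {1}(coord_basis z_basis (memvf c)); apply: eq_bigr => i _.
rewrite /zcoord (tnth_nth 0); case: (coord z i c) => [[|[|k]]] // lt_k.
  by rewrite [Ordinal _](_ : _ = 0) ?scale0r //; apply: val_inj.
by rewrite [Ordinal _](_ : _ = 1) ?scale1r //; apply: val_inj.
Qed.

Lemma basis_neq0 i : tnth z i != 0.
Proof.
apply: contraTneq (basis_free z_basis) => z0; apply/negP => z_free.
by have := zcoord_basis i i; rewrite /zcoord z0 linear0 !eqxx.
Qed.

End Coordinates.

(** * Signs produced by multiplying ordered products of generators *)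

Section OrderedProduct.
Variables (K : fieldType) (A : falgType K) (N : nat) (theta : 'I_N -> A).
Variables (s : 'I_N -> bool) (t : 'I_N -> 'I_N -> bool).

(* The sign exponent produced by moving theta_j to the left of theta_i (j < i), *)
(* or by theta_i^2 when i = j.                                                 *)
Definition crossing (i j : 'I_N) : bool :=
  if i == j then s i else (j < i)%N && t j i.

Hypothesis theta_sq : forall i, theta i ^+ 2 = (-1) ^+ s i.
Hypothesis theta_swap : forall i j : 'I_N, (i < j)%N ->
  theta j * theta i = (-1) ^+ t i j * (theta i * theta j).

Definition oprod (r : seq 'I_N) (u : 'I_N -> bool) : A :=
  \prod_(i <- r) theta i ^+ u i.

Lemma mulr_signCA (b : bool) (x y : A) : x * ((-1) ^+ b * y) = (-1) ^+ b * (x * y).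
Proof. by rewrite mulrA commr_sign mulrA. Qed.

Lemma oprod_swap (i : 'I_N) (b : bool) r u : all (fun j : 'I_N => i < j)%N r ->
  oprod r u * theta i ^+ b =
  (-1) ^+ (\big[addb/false]_(j <- r) [&& u j, b & crossing j i]) *
    (theta i ^+ b * oprod r u).
Proof.
rewrite /oprod; elim: r => [|j r IHr] /=.
  by rewrite !big_nil mulr1 !mul1r.
case/andP=> ij /IHr{}IHr; rewrite !big_cons -mulrA IHr signr_addb.
rewrite mulr_signCA -[RHS]mulrA [RHS]mulr_signCA; congr (_ * _).
rewrite !mulrA; congr (_ * _).
have -> : crossing j i = t i j.
  by rewrite /crossing -val_eqE gtn_eqF // ij.
case: (u j); case: b {IHr}; rewrite ?expr0 ?mulr1 ?mul1r //= !expr1.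
by rewrite theta_swap // mulrA.
Qed.

(** Induction on r: the head of the second product is moved left through the tail of the first and
    merges there with the head of the first. The resulting exponent is a bilinear form over Z/2
    evaluated at u and v, which is the origin of the biadditive q. *)
Lemma oprodM r u v : pairwise (fun i j : 'I_N => i < j)%N r ->
  oprod r u * oprod r v =
  (-1) ^+ (\big[addb/false]_(i <- r) \big[addb/false]_(j <- r)
             [&& u i, v j & crossing i j]) *
    oprod r (fun i => u i (+) v i).
Proof.
rewrite /oprod; elim: r => [|i r IHr]; first by rewrite !big_nil !mulr1.
rewrite pairwise_cons => /andP[ir r_sorted].
rewrite !big_cons -mulrA [X in _ * X]mulrA oprod_swap //.
have -> : \big[addb/false]_(k <- r) \big[addb/false]_(j <- i :: r)
      [&& u k, v j & crossing k j] =
    \big[addb/false]_(k <- r) [&& u k, v i & crossing k i] (+)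
    \big[addb/false]_(k <- r) \big[addb/false]_(j <- r) [&& u k, v j & crossing k j].
  by rewrite -big_split; apply: eq_bigr => k _; rewrite big_cons.
rewrite !signr_addb.
(* The head of the first product already stands to the left of every theta_j with j > i, so it
   contributes no crossing with the tail. *)
have -> : \big[addb/false]_(j <- r) [&& u i, v j & crossing i j] = false.
  rewrite big_seq big1 // => j /(allP ir) ij.
  by rewrite /crossing -val_eqE ltn_eqF // ltnNge (ltnW ij) /= !andbF.
have -> : theta i ^+ (u i (+) v i) = (-1) ^+ [&& u i, v i & crossing i i] *
    (theta i ^+ u i * theta i ^+ v i).
  rewrite /crossing eqxx; case: (u i); case: (v i); rewrite ?expr0 ?mul1r ?mulr1 //=.
  by rewrite !expr1 -expr2 theta_sq -expr2 sqrr_sign.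
rewrite expr0 mulr1.
have := IHr r_sorted; set e3 := \big[_/_]_(j <- r) _ => IH.
set e1 := [&& _, _ & _]; set e2 := \big[_/_]_(j <- r) _.
rewrite -[X in _ * X = _]mulrA mulr_signCA -[X in _ * (_ * X) = _]mulrA IH.
rewrite [X in _ * (_ * X) = _]mulr_signCA [X in _ * X = _]mulr_signCA.
rewrite -[X in _ = _ * X]mulrA [RHS]mulr_signCA !mulrA.
by rewrite -[(-1) ^+ e1 * _]expr2 sqrr_sign mul1r.
Qed.

End OrderedProduct.

(** * Normalised generators and the twist they determine *)

Section Frames.
Variables (K : fieldType) (N : nat) (z : N.-tuple 'rV['F_2]_N).
Hypothesis z_basis : basis_of fullv z.
Variables (B : falgType K) (tau : {lrmorphism B -> B}).
Hypothesis tauK : involutive tau.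
Local Notation V := 'rV['F_2]_N.

(* Only the first generator may act nontrivially on D_0; tau = id covers the    *)
(* cases (1)-(3).                                                               *)
Definition gen_act (i : 'I_N) : {lrmorphism B -> B} :=
  if i == 0%N :> nat then tau else idfun.

Record frame (D : gradedAlg K V) (phi : {lrmorphism B -> D}) (theta : 'I_N -> D)
    (s : 'I_N -> bool) : Prop := Frame {
  fr_id : identifies0 phi;
  fr_mem : forall i, theta i \in gcomp D (tnth z i);
  fr_comm : forall i x, theta i * phi x = phi (gen_act i x) * theta i;
  fr_sq : forall i, theta i ^+ 2 = (-1) ^+ s i
}.

Definition swaps (D : gradedAlg K V) (theta : 'I_N -> D)
    (t : 'I_N -> 'I_N -> bool) : Prop :=
  forall i j : 'I_N, (i < j)%N ->
    theta j * theta i = (-1) ^+ t i j * (theta i * theta j).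

Section FrameTwist.
Variables (s : 'I_N -> bool) (t : 'I_N -> 'I_N -> bool).

(** The first coordinate of c, written as a sum so that it also makes sense for N = 0 and is
    additive term by term. *)
Definition frame_chi (c : V) : bool :=
  \big[addb/false]_(i : 'I_N) ((i == 0%N :> nat) && zcoord z c i).

(** The bilinear form over Z/2 whose matrix in the basis z is [crossing s t]: squares on the
    diagonal, commutation signs below it, zero above it. *)
Definition frame_q (a b : V) : bool :=
  \big[addb/false]_i \big[addb/false]_j
    [&& zcoord z a i, zcoord z b j & crossing s t i j].

Lemma frame_chiD : {morph frame_chi : a b / a + b >-> a (+) b}.
Proof.
move=> a b; rewrite /frame_chi -big_split; apply: eq_bigr => i _.
by rewrite zcoordD andb_addr.
Qed.

Lemma frame_qDl c : {morph frame_q^~ c : a b / a + b >-> a (+) b}.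
Proof.
move=> a b; rewrite /frame_q -big_split; apply: eq_bigr => i _.
by rewrite -big_split; apply: eq_bigr => j _; rewrite zcoordD andb_addl.
Qed.

Lemma frame_qDr c : {morph frame_q c : a b / a + b >-> a (+) b}.
Proof.
move=> a b; rewrite /frame_q -big_split; apply: eq_bigr => i _.
rewrite -big_split; apply: eq_bigr => j _.
by rewrite zcoordD andb_addl andb_addr.
Qed.

Definition frame_twist : twist V B := Twist tauK frame_chiD frame_qDl frame_qDr.

Lemma frame_act_basis i : tw_act frame_twist (tnth z i) =1 gen_act i.
Proof.
move=> x; rewrite /tw_act /= /gen_act /frame_chi (bigD1 i) //= big1 => [|j ji].
  by rewrite zcoord_basis // eqxx andbT addbF.
by rewrite zcoord_basis // [i == j]eq_sym (negPf ji) andbF.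
Qed.

Lemma frame_q_basis i j : frame_q (tnth z i) (tnth z j) = crossing s t i j.
Proof.
rewrite /frame_q (bigD1 i) //= [X in _ (+) X]big1 => [|k ki]; last first.
  by rewrite big1 // => l _; rewrite zcoord_basis // eq_sym (negPf ki).
rewrite (bigD1 j) //= big1 => [|l lj]; last first.
  by rewrite !zcoord_basis // (eq_sym j) (negPf lj) andbF.
by rewrite !zcoord_basis // !eqxx !addbF.
Qed.

Variables (D : gradedAlg K V) (phi : {lrmorphism B -> D}).

Lemma twisted_basis_frame (X : V -> D) : twisted_basis frame_twist phi X ->
  frame phi (fun i => X (tnth z i)) s /\ swaps (fun i => X (tnth z i)) t.
Proof.
move=> XW; split; first split=> [|i|i x|i].
- exact: tb_id XW.
- exact: tb_mem XW _.
- by rewrite (tb_comm XW) frame_act_basis.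
- rewrite expr2 (tb_sqr (@F2_addrr N) XW) /= frame_q_basis /crossing eqxx.
  by rewrite -(rmorph_sign (in_alg D)).
move=> i j ij; rewrite !(tb_mul XW) /= !frame_q_basis /crossing -!val_eqE.
rewrite gtn_eqF // ltn_eqF // ij ltnNge (ltnW ij) /= scale1r addrC.
by rewrite mulr_sign scaler_sign.
Qed.

Variable theta : 'I_N -> D.
Hypotheses (phi_fr : frame phi theta s) (theta_swap : swaps theta t).

Let X (c : V) : D := oprod theta (enum 'I_N) (zcoord z c).

Lemma frame_twisted_basis : twisted_basis frame_twist phi X.
Proof.
split=> [|c||c x|a b].
- exact: fr_id phi_fr.
- rewrite [X in gcomp D X](zcoord_sum z_basis) /X /oprod -big_enum /=.
  elim: (enum _) => [|i r IHr]; first by rewrite !big_nil gcomp1.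
  rewrite !big_cons gcompM //; case: (zcoord z c i); last exact: gcomp1.
  by rewrite expr1; apply: fr_mem phi_fr i.
- rewrite /X /oprod big1 // => i _.
  by rewrite /zcoord linear0 eqxx.
- rewrite /tw_act /= /frame_chi /X /oprod -big_enum /=.
  (* Moving [phi x] through the ordered product composes the actions of its factors; as these are id
     or the involution [tau], only the parity of the occurrences of [tau] matters. *)
  have -> y : (if \big[addb/false]_(i <- enum 'I_N)
        ((nat_of_ord i == 0%N) && zcoord z c i) then tau else idfun) y =
      foldr (fun i y => if zcoord z c i then gen_act i y else y) y (enum 'I_N).
    elim: (enum _) => [|i r /= <-]; first by rewrite big_nil.
    rewrite big_cons /gen_act.
    by case: eqP; case: (zcoord z c i); case: (\big[_/_]_(j <- r) _); rewrite /= ?tauK.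
  elim: (enum _) => [|i r IHr] /=; first by rewrite !big_nil mulr1 mul1r.
  rewrite !big_cons -mulrA IHr mulrA; case: (zcoord z c i).
    by rewrite (fr_comm phi_fr) mulrA.
  by rewrite expr0 !mul1r.
have enum_sorted : pairwise (fun i j : 'I_N => i < j)%N (enum 'I_N).
  rewrite -(@pairwise_map _ _ val ltn) val_enum_ord -(sorted_pairwise ltn_trans).
  exact: iota_ltn_sorted.
rewrite /X (oprodM (fr_sq phi_fr) theta_swap) //.
rewrite [X in _ * X = _](_ : _ = oprod theta (enum 'I_N) (zcoord z (a + b))); last first.
  by apply: eq_bigr => i _; rewrite zcoordD.
rewrite mulr_sign scaler_sign /= /frame_q -!big_enum /=.
under [in RHS]eq_bigr do rewrite -big_enum /=.
by [].
Qed.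

End FrameTwist.

(** The cocycle is built from the commutation signs t_ij, whereas the classification uses a_ij.
    Swapping the two middle factors of theta_i theta_j theta_i theta_j relates them. *)
Lemma frame_signs (D : gradedAlg K V) (phi : {lrmorphism B -> D}) theta s t (i j : 'I_N) :
  frame phi theta s -> swaps theta t -> (i < j)%N ->
  (theta i * theta j) ^+ 2 = (-1) ^+ (t i j (+) s i (+) s j).
Proof.
move=> fr sw ij; rewrite expr2 mulrA -[_ * theta j * theta i]mulrA sw //.
rewrite mulr_signCA mulrA -!mulrA -[theta j * theta j]expr2 (fr_sq fr).
rewrite !mulrA -[_ * theta i * theta i]mulrA -expr2 (fr_sq fr).
by rewrite !signr_addb.
Qed.

End Frames.

Lemma sign_inj (K : fieldType) (A : falgType K) (b b' : bool) :
  (-1 : K) != 1 -> (-1) ^+ b = (-1) ^+ b' :> A -> b = b'.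
Proof.
move=> neq1; have neqA : (-1 : A) != 1.
  rewrite -(rmorphN1 (in_alg A)) -(rmorph1 (in_alg A)).
  by rewrite (inj_eq (fmorph_inj _)).
by case: b b' => [] [] // /eqP; rewrite ?(negPf neqA) // eq_sym (negPf neqA).
Qed.

Lemma sqr1_sign (K : fieldType) (A : falgType K) (x : A) :
  (forall y : A, y != 0 -> y \is a GRing.unit) -> x * x = 1 ->
  exists b : bool, x = (-1) ^+ b.
Proof.
move=> Adiv xx; have [|x1] := eqVneq (x - 1) 0.
  by move/eqP; rewrite subr_eq0 => /eqP->; exists false.
have /(congr1 ( *%R (x - 1)^-1)) : (x - 1) * (x + 1) = 0.
  by rewrite mulrDl !mulrDr xx !mulr1 mulN1r [1 + x]addrC addrACA !subrr addr0.
rewrite mulKr ?Adiv // mulr0 => /eqP; rewrite addr_eq0 => /eqP->.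
by exists true.
Qed.

Section FrameTheory.
Variables (K : fieldType) (N : nat) (z : N.-tuple 'rV['F_2]_N).
Hypothesis z_basis : basis_of fullv z.
Variables (B : falgType K) (tau : {lrmorphism B -> B}).
Hypothesis tauK : involutive tau.
Hypothesis Bdiv : forall x : B, x != 0 -> x \is a GRing.unit.
Local Notation V := 'rV['F_2]_N.

Lemma gen_actK (i : 'I_N) : involutive (gen_act tau i : B -> B).
Proof. by rewrite /gen_act; case: eqP => [_|_ //]; apply: tauK. Qed.

Lemma gen_act_id (i : 'I_N) x : i != 0%N :> nat -> gen_act tau i x = x.
Proof. by rewrite /gen_act => /negPf->. Qed.

(** Reduces invariance of the signs under graded isomorphism to a comparison of two systems of
    generators inside the single algebra D'. *)
Lemma frame_transport (D D' : gradedAlg K V) (f : {lrmorphism D -> D'})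
    (phi : {lrmorphism B -> D}) theta s :
  is_graded_iso f -> frame z tau phi theta s ->
  exists phi' : {lrmorphism B -> D'}, frame z tau phi' (f \o theta) s.
Proof.
move=> f_iso fr; exists (f \o phi : {lrmorphism B -> D'}); split=> [|i|i x|i].
- have [[f_bij _] [phi_inj D0]] := (f_iso, fr_id fr).
  split=> [|x]; first exact: inj_comp (bij_inj f_bij) phi_inj.
  have [g [g_iso fK gK]] := graded_iso_inv f_iso.
  rewrite -(graded_iso_mem _ _ g_iso); split=> [/D0[d dE]|[d <-]].
    by exists d; rewrite /= dE.
  by apply/D0; exists d; rewrite /= fK.
- by rewrite (graded_iso_mem _ _ f_iso) (fr_mem fr).
- by rewrite /= -!rmorphM (fr_comm fr).
- by rewrite /= -rmorphXn (fr_sq fr) rmorph_sign.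
Qed.

Section OneFrame.
Variables (D : gradedAlg K V) (phi : {lrmorphism B -> D}) (theta : 'I_N -> D).
Variable s : 'I_N -> bool.
Hypothesis fr : frame z tau phi theta s.

Lemma frame_rreg i x y : x * theta i = y * theta i -> x = y.
Proof.
move/(congr1 ( *%R^~ (theta i))); rewrite -!mulrA -expr2 (fr_sq fr).
by move/(congr1 ( *%R^~ ((-1) ^+ s i))); rewrite -!mulrA -expr2 sqrr_sign !mulr1.
Qed.

Lemma frame_lreg i x y : theta i * x = theta i * y -> x = y.
Proof.
move/(congr1 ( *%R (theta i))); rewrite !mulrA -expr2 (fr_sq fr).
by move/(congr1 ( *%R ((-1) ^+ s i))); rewrite !mulrA -expr2 sqrr_sign !mul1r.
Qed.

Lemma frame_homog i x : x \in gcomp D (tnth z i) -> exists y, x = phi y * theta i.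
Proof.
move=> Dx; have [_ D0] := fr_id fr.
have /D0[y yE] : x * theta i \in gcomp D 0.
  by rewrite -(F2_addrr (tnth z i)) gcompM ?(fr_mem fr).
exists (y * (-1) ^+ s i); rewrite rmorphM rmorph_sign /= yE.
rewrite -mulrA mulr_signCA -(mulrA x) -expr2 (fr_sq fr) commr_sign mulrA.
by rewrite -expr2 sqrr_sign mul1r.
Qed.

(** Multiply (theta_i theta_j)^2 by theta_i on the left and by theta_j on the right: the outer
    squares are signs, and theta_j theta_i remains in the middle. *)
Lemma frame_swap_sign i j (b : bool) : (theta i * theta j) ^+ 2 = (-1) ^+ b ->
  theta j * theta i = (-1) ^+ (b (+) s i (+) s j) * (theta i * theta j).
Proof.
rewrite expr2 => E.
have : (theta i * theta i) * (theta j * theta i) * (theta j * theta j) =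
    (-1) ^+ b * (theta i * theta j).
  transitivity (theta i * (theta i * theta j * (theta i * theta j)) * theta j).
    by rewrite !mulrA.
  by rewrite E commr_sign mulrA.
rewrite -!expr2 !(fr_sq fr) commr_sign [LHS]mulrA -signr_addb => Es.
rewrite -addbA addbC signr_addb -mulrA -Es [RHS]mulrA -signr_addb.
by rewrite [s j (+) _]addbC addbb mul1r.
Qed.

(* theta_j commutes with D_0, hence with (theta_j theta_i)^2; so this square   *)
(* equals (theta_i theta_j)^2, and the product of the two is a product of      *)
(* squares of generators.                                                      *)
Lemma frame_prod_sq (i j : 'I_N) : j != 0%N :> nat ->
  exists b : bool, (theta i * theta j) ^+ 2 = (-1) ^+ b /\
                   (theta j * theta i) ^+ 2 = (-1) ^+ b.
Proof.
move=> j0; have [phi_inj D0] := fr_id fr.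
have /D0[m mE] : (theta j * theta i) ^+ 2 \in gcomp D 0.
  rewrite expr2 -(F2_addrr (tnth z j + tnth z i)).
  by rewrite gcompM // gcompM ?(fr_mem fr).
have ijE : (theta i * theta j) ^+ 2 = phi m.
  apply: (@frame_lreg j); rewrite (fr_comm fr) gen_act_id // mE !expr2.
  by rewrite !mulrA.
have [||b mb] := @sqr1_sign K B m => //.
  apply: phi_inj; rewrite rmorphM rmorph1 /= -{1}ijE mE !expr2.
  have sqL k x : theta k * (theta k * x) = (-1) ^+ s k * x.
    by rewrite mulrA -expr2 (fr_sq fr).
  have C k (b : bool) x : theta k * ((-1) ^+ b * x) = (-1) ^+ b * (theta k * x).
    exact: mulr_signCA.
  rewrite -!mulrA !(sqL, C) -expr2 (fr_sq fr) -!signr_addb.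
  by case: (s i); case: (s j).
by exists b; rewrite ijE -mE mb rmorph_sign.
Qed.

Lemma frame_swaps a : has_signs theta a ->
  swaps theta (fun i j => a i j (+) s i (+) s j).
Proof. by move=> th_a i j ij; apply: frame_swap_sign; apply: th_a. Qed.

Lemma frame_products : products_square_to_signs theta.
Proof.
have sgn (b : bool) : (-1) ^+ b = 1 :> D \/ (-1) ^+ b = -1 :> D.
  by case: b; [right; rewrite expr1 | left; rewrite expr0].
move=> i j ij; have [j0|j0] := eqVneq (j : nat) 0%N.
  have i0 : i != 0%N :> nat by rewrite -j0; apply: contraNneq ij => /val_inj->.
  by have [b [_ ->]] := frame_prod_sq j i0; apply: sgn.
by have [b [-> _]] := frame_prod_sq i j0; apply: sgn.
Qed.

(** Both generators of degree z_i act on D_0 by the same automorphism, so their quotient y_i is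
    central in D_0; squaring y_i theta_i gives the norm equation. *)
Lemma frame_compare theta' s' : frame z tau phi theta' s' ->
  exists y : 'I_N -> B, forall i,
    [/\ theta' i = phi (y i) * theta i, forall x, x * y i = y i * x
      & y i * gen_act tau i (y i) * (-1) ^+ s i = (-1) ^+ s' i].
Proof.
move=> fr'; have [phi_inj _] := fr_id fr.
have /(@fin_all_exists _ _ (fun i y => theta' i = phi y * theta i))[y yE] i :
    exists y, theta' i = phi y * theta i.
  exact/frame_homog/(fr_mem fr').
exists y => i; have y_act x : x * y i = y i * x.
  rewrite -(gen_actK i x); apply: phi_inj; apply: (@frame_rreg i).
  rewrite !rmorphM /= -[RHS]mulrA -(fr_comm fr) -mulrA -yE mulrA -yE.
  by rewrite (fr_comm fr').
split=> //; apply: phi_inj; rewrite !rmorphM /= !rmorph_sign -(fr_sq fr).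
rewrite -(fr_sq fr') !expr2 yE !mulrA; congr (_ * _).
by rewrite -!mulrA (fr_comm fr).
Qed.

End OneFrame.
End FrameTheory.

(** * The classification from generators *)

Section Classification.
Variables (K : fieldType) (N : nat) (z : N.-tuple 'rV['F_2]_N).
Hypothesis z_basis : basis_of fullv z.
Hypothesis neq1 : (-1 : K) != 1.
Variables (B : falgType K) (tau : {lrmorphism B -> B}).
Hypothesis tauK : involutive tau.
Hypothesis Bdiv : forall x : B, x != 0 -> x \is a GRing.unit.
Local Notation V := 'rV['F_2]_N.
Implicit Types D : gradedAlg K V.

(* sgn_ok i s: the value (-1)^s is allowed for the square of theta_i.            *)
Variables (P : gradedAlg K V -> Prop)
  (gens : forall D : gradedAlg K V, ('I_N -> D) -> Prop)
  (allowed : 'I_N -> gradedAlg K 'F_2 -> Prop)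
  (sgn_ok : 'I_N -> bool -> Prop) (mdl : 'I_N -> bool -> gradedAlg K 'F_2).

(** The element y is the quotient of two normalised generators of the same degree. The hypothesis
    makes the sign of theta_i^2 independent of the choice and forces y to be unitary. *)
Hypothesis sgn_uniq : forall i s s' (y : B), sgn_ok i s -> sgn_ok i s' ->
  (forall x, x * y = y * x) -> y * gen_act tau i y * (-1) ^+ s' = (-1) ^+ s ->
  s = s' /\ y * gen_act tau i y = 1.
(** The element a is the square of some x in D_(z_i); replacing x by b x multiplies this square by
    the twisted norm of b. *)
Hypothesis sgn_norm : forall i (a : B), a != 0 -> (forall x, x * a = a * x) ->
  gen_act tau i a = a ->
  exists (b : B) s, [/\ forall x, x * b = b * x, sgn_ok i s
    & b * gen_act tau i b * a = (-1) ^+ s].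
Hypothesis P_div : forall D, P D -> full_division_alg D.
Hypothesis P_frames : forall D, P D ->
  exists phi : {lrmorphism B -> D}, [/\ identifies0 phi,
    forall i, exists x, [/\ x \in gcomp D (tnth z i), x != 0
                          & forall d, x * phi d = phi (gen_act tau i d) * x]
  & forall theta, gens theta -> exists s, frame z tau phi theta s /\
      forall i, sgn_ok i (s i)].
Hypothesis frame_P : forall D (phi : {lrmorphism B -> D}) theta s,
  full_division_alg D -> frame z tau phi theta s -> (forall i, sgn_ok i (s i)) ->
  P D /\ gens theta.
Hypothesis mdl_frame : forall D (phi : {lrmorphism B -> D}) theta s i,
  frame z tau phi theta s -> graded_iso (Z2sub D (tnth z i)) (mdl i (s i)).
Hypothesis mdl_inj : forall i s s', sgn_ok i s -> sgn_ok i s' ->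
  graded_iso (mdl i s) (mdl i s') -> s = s'.
Hypothesis allowedE : forall i E,
  allowed i E <-> exists2 s, sgn_ok i s & graded_iso E (mdl i s).

(** Take a nonzero x of degree z_i with the prescribed action. Then a = x^2 lies in D_0, is central
    because the action is an involution, and is fixed by the action because x commutes with x^2.
    Hence [sgn_norm] applies. *)
Lemma gens_exist D : P D -> exists theta : 'I_N -> D, gens theta.
Proof.
move=> PD; have [phi [phi0 xP _]] := P_frames PD.
have [phi_inj D0] := phi0; have [D_div _] := P_div PD.
have gen i : exists th (s : bool), [/\ sgn_ok i s, th \in gcomp D (tnth z i),
    forall d, th * phi d = phi (gen_act tau i d) * th & th ^+ 2 = (-1) ^+ s].
  have [x [Dx x0 x_phi]] := xP i; have Ux := D_div _ _ Dx x0.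
  have /D0[a aE] : x * x \in gcomp D 0.
    by rewrite -(F2_addrr (tnth z i)) gcompM.
  have a0 : a != 0.
    apply: contraTneq Ux => a0; have := aE; rewrite a0 rmorph0 => /esym xx.
    apply/negP => Ux; move: x0; rewrite -(inj_eq (mulIr Ux)) mul0r xx.
    by rewrite eqxx.
  have aC d : d * a = a * d.
    apply: phi_inj; rewrite !rmorphM /= aE -[RHS]mulrA x_phi [RHS]mulrA x_phi.
    by rewrite gen_actK // mulrA.
  have a_act : gen_act tau i a = a.
    by apply: phi_inj; apply: (mulIr Ux); rewrite -x_phi aE mulrA.
  have [b [s [bC s_ok bE]]] := sgn_norm a0 aC a_act.
  exists (phi b * x), s; split=> // [|d|].
  - by rewrite -[tnth z i]add0r gcompM // identifies0_mem.
  - by rewrite -mulrA x_phi !mulrA -!rmorphM bC.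
  by rewrite expr2 mulrA -[_ * x * _]mulrA x_phi mulrA -mulrA -aE -!rmorphM bE
    rmorph_sign.
have [theta thetaP] := fin_all_exists gen.
have [s sP] := fin_all_exists thetaP.
exists theta; have fr : frame z tau phi theta s.
  by split=> // [i|i x|i]; have [] := sP i.
by have [] := frame_P (P_div PD) fr (fun i => let: And4 ok _ _ _ := sP i in ok).
Qed.

Lemma normal_form : has_normal_form z P gens allowed.
Proof.
move=> D PD; have [phi [phi0 xP gensP]] := P_frames PD; split.
- exact: gens_exist.
- by move=> theta /gensP[s [fr _]]; apply: frame_products fr.
move=> i; have [theta /gensP[s [fr s_ok]]] := gens_exist PD.
by apply/allowedE; exists (s i) => //; apply: mdl_frame fr.
Qed.

(** Since i < j, theta_j acts trivially on D_0, so y_j^2 = 1 and y_j is a sign, which disappears on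
    squaring. The factor y_i need not be a sign; it commutes with theta_j, and (y_i theta_i
    theta_j)^2 gathers y_i sigma_i(y_i) = 1. *)
Lemma frame_signs_uniq D (phi : {lrmorphism B -> D}) theta theta' s s' a a' :
  frame z tau phi theta s -> frame z tau phi theta' s' ->
  (forall i, sgn_ok i (s i)) -> (forall i, sgn_ok i (s' i)) ->
  has_signs theta a -> has_signs theta' a' ->
  forall i j : 'I_N, (i < j)%N -> a i j = a' i j.
Proof.
move=> fr fr' s_ok s'_ok th_a th'_a' i j ij.
apply: (sign_inj (A := D) neq1); rewrite -th_a // -th'_a' //.
have [y yP] := frame_compare tauK fr fr'.
have [yi yiC yiE] := yP i; have [yj yjC yjE] := yP j.
have [_ yi1] := sgn_uniq (s'_ok i) (s_ok i) yiC yiE.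
have [_] := sgn_uniq (s'_ok j) (s_ok j) yjC yjE.
have j0 : j != 0%N :> nat by rewrite -lt0n (leq_ltn_trans _ ij).
rewrite gen_act_id // => /(sqr1_sign Bdiv)[b bE].
rewrite yi yj bE rmorph_sign [_ * ((-1) ^+ b * _)]mulr_signCA.
rewrite [RHS]exprMn_comm; last first.
  exact/commr_sym/commr_sign.
have Cj : theta j * phi (y i) = phi (y i) * theta j.
  by rewrite (fr_comm fr) gen_act_id.
rewrite sqrr_sign mul1r !expr2 !mulrA -(mulrA _ (theta j) (phi _)) Cj !mulrA.
rewrite -(mulrA _ (theta i) (phi _)) (fr_comm fr) mulrA -rmorphM yi1.
by rewrite rmorph1 mul1r.
Qed.

Lemma frame_iso D D' (phi : {lrmorphism B -> D}) (phi' : {lrmorphism B -> D'})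
    theta theta' s t :
  frame z tau phi theta s -> frame z tau phi' theta' s ->
  swaps theta t -> swaps theta' t -> graded_iso D D'.
Proof.
move=> fr fr' sw sw'.
have b := frame_twisted_basis z_basis tauK fr sw.
have b' := frame_twisted_basis z_basis tauK fr' sw'.
exact: (twisted_basis_iso (@F2_addrr N) b b').
Qed.

Lemma classification : classified_by z P gens allowed.
Proof.
split=> [D D' theta theta' a a' PD PD' g g' th_a th_a'|E a E_ok].
  have [phi [phi0 _ /(_ _ g)[s [fr s_ok]]]] := P_frames PD.
  have [phi' [phi'0 _ gensP']] := P_frames PD'.
  have [s' [fr' s'_ok]] := gensP' _ g'.
  split=> [[f f_iso]|[D_iso aa]].
    have [phi'' fr''] := frame_transport f_iso fr.
    split=> [i|i j ij].
      apply: graded_iso_trans (mdl_frame i fr) _.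
      exact/graded_iso_sym/mdl_frame/fr''.
    (* The transported frame uses its own identification of D_0, while the comparison needs a common
       one. Passing through [gens] turns the same generators into a frame over [phi']. *)
    have [_ gf] := frame_P (P_div PD') fr'' s_ok.
    have [s2 [fr2 s2_ok]] := gensP' _ gf.
    apply: (frame_signs_uniq fr2 fr' s2_ok s'_ok) => // k l kl.
    by rewrite -rmorphM -rmorphXn th_a // rmorph_sign.
  have ss i : s i = s' i.
    apply: mdl_inj (s_ok i) (s'_ok i) _.
    apply: graded_iso_trans (graded_iso_sym (mdl_frame i fr)) _.
    exact: graded_iso_trans (D_iso i) (mdl_frame i fr').
  have fr2 : frame z tau phi' theta' s.
    by case: fr' => id' mem' comm' sq'; split=> // i; rewrite ss.
  apply: (frame_iso fr fr2 (frame_swaps fr th_a)).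
  by move=> i j ij; rewrite (frame_swaps fr2 th_a') // aa.
have /fin_all_exists[s sP] i : exists s, sgn_ok i s /\ graded_iso (E i) (mdl i s).
  by have /allowedE[s] := E_ok i; exists s.
(* Solves the formula of [frame_signs] for the commutation signs, so that the prescribed a_ij come
   out. *)
pose t i j := a i j (+) s i (+) s j.
pose W := frame_twist z tauK s t.
have [phi phiW] := twisted_has_basis W.
have [fr sw] := twisted_basis_frame z_basis phiW.
have D_div : full_division_alg (twisted_graded W).
  exact: twisted_full_division (@F2_addrr N).
have s_ok i : sgn_ok i (s i) by case: (sP i).
have [PD gD] := frame_P D_div fr s_ok.
exists (twisted_graded W), (fun i => tw_elt W (tnth z i) 1); split=> //.
  move=> i j ij; rewrite (frame_signs fr sw ij); congr (_ ^+ nat_of_bool _).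
  by rewrite /t; case: (a i j); case: (s i); case: (s j).
move=> i; apply: graded_iso_trans (mdl_frame i fr) _.
by apply: graded_iso_sym; case: (sP i).
Qed.

End Classification.

Lemma numField_neqN1 (K : numFieldType) : (-1 : K) != 1.
Proof. by rewrite eq_sym -subr_eq0 opprK (pnatr_eq0 K 2). Qed.

Lemma frame_swaps_exist (K : fieldType) (N : nat) (z : N.-tuple 'rV['F_2]_N)
    (B : falgType K) (tau : {lrmorphism B -> B})
    (Bdiv : forall x : B, x != 0 -> x \is a GRing.unit)
    (D : gradedAlg K 'rV['F_2]_N) (phi : {lrmorphism B -> D}) theta s :
  frame z tau phi theta s -> exists t, swaps theta t.
Proof.
move=> fr; exists (fun i j => theta j * theta i != theta i * theta j) => i j ij.
have j0 : j != 0%N :> nat by rewrite -lt0n (leq_ltn_trans _ ij).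
have [b [/(frame_swap_sign fr) E _]] := frame_prod_sq Bdiv fr i j0.
have [->|] := eqVneq; first by rewrite mul1r.
by rewrite E; case: (_ (+) _) => //; rewrite mul1r eqxx.
Qed.

(** * Generators that commute with D_0 *)

Section IdFrames.
Variables (K : fieldType) (N : nat) (z : N.-tuple 'rV['F_2]_N).
Hypothesis z_basis : basis_of fullv z.
Variable B : falgType K.
Hypothesis Bdiv : forall x : B, x != 0 -> x \is a GRing.unit.
Implicit Type D : gradedAlg K 'rV['F_2]_N.
Local Notation id_frame := (frame z (idfun : {lrmorphism B -> B})).

Lemma gen_act_idfun (i : 'I_N) (x : B) : gen_act idfun i x = x.
Proof. by rewrite /gen_act; case: ifP. Qed.

Lemma id_frame_crossed D (phi : {lrmorphism B -> D}) theta s i : id_frame phi theta s ->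
  exists f : {lrmorphism Z2sub D (tnth z i) -> crossed_graded (idData B (s i))},
    is_graded_iso f /\
    forall w x, Z2sub_val w = phi x -> f w = crossed_in (idData B (s i)) x.
Proof.
move=> fr; apply: (Z2sub_crossed (d := idData B (s i)) (fr_id fr)
  (basis_neq0 z_basis i) (fr_mem fr i)).
  by move=> x; rewrite (fr_comm fr) gen_act_idfun.
by rewrite (fr_sq fr) rmorph_sign.
Qed.

Lemma id_frame_iso D (phi : {lrmorphism B -> D}) theta s i : id_frame phi theta s ->
  graded_iso (Z2sub D (tnth z i)) (crossed_graded (idData B (s i))).
Proof. by case/(id_frame_crossed i) => f [f_iso _]; exists f. Qed.

Lemma id_frame_comm D (phi : {lrmorphism B -> D}) theta s : id_frame phi theta s ->
  forall i, commutes_with0 (theta i).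
Proof.
move=> fr i d; have [_ D0] := fr_id fr => /D0[x <-].
by rewrite (fr_comm fr) gen_act_idfun.
Qed.

(** Each homogeneous element is y X_c with y in D_0, and X_c commutes with D_0 because the
    generators do. This verifies the defining condition of case (3) for the algebras constructed
    from given data. *)
Lemma id_frame_commute0 D (phi : {lrmorphism B -> D}) theta s :
  (forall x y : B, x * y = y * x) -> id_frame phi theta s -> homogeneous_commute0 D.
Proof.
move=> Bcomm fr; have [t sw] := frame_swaps_exist Bdiv fr.
have idK : involutive (idfun : B -> B) by [].
have XW := frame_twisted_basis z_basis idK fr sw.
move=> c x /(tb_homog (@F2_addrr N) XW)[y ->] d.
have [_ D0] := fr_id fr => /D0[e <-].
rewrite -mulrA (tb_comm XW) mulrA [RHS]mulrA -!rmorphM Bcomm; congr (phi (_ * _) * _).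
by rewrite /tw_act; case: ifP.
Qed.

Section SquareRoots.
Hypothesis Bcomm : forall x y : B, x * y = y * x.
Hypothesis Bsqrt : forall a : B, exists b, b * b = a.
Hypothesis neq1 : (-1 : K) != 1.
Variables (P : gradedAlg K 'rV['F_2]_N -> Prop)
  (allowed : 'I_N -> gradedAlg K 'F_2 -> Prop).
Hypothesis P_div : forall D, P D -> full_division_alg D.
Hypothesis P_phi : forall D, P D -> exists phi : {lrmorphism B -> D},
  identifies0 phi /\ homogeneous_commute0 D.
Hypothesis frame_P : forall D (phi : {lrmorphism B -> D}) theta s,
  full_division_alg D -> id_frame phi theta s -> P D.
Hypothesis allowedE : forall i E,
  allowed i E <-> graded_iso E (crossed_graded (idData B false)).

Lemma square_one_frame D (phi : {lrmorphism B -> D}) (theta : 'I_N -> D) :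
  identifies0 phi -> square_one_gens z theta -> id_frame phi theta (fun=> false).
Proof.
move=> phi0 g; split=> // [i|i x|i]; have [g1 g2 g3] := g i => //.
by rewrite gen_act_idfun g2 // identifies0_mem.
Qed.

(** Cases (1) and (3) share this argument over two base fields: D_0 is a field in which each element
    has a square root, so every theta_i^2 can be normalised to 1 and no sign is left in D_i. *)
Lemma sqrt_classification :
  has_normal_form z P (@square_one_gens K N z) allowed /\
  classified_by z P (@square_one_gens K N z) allowed.
Proof.
have idK : involutive (idfun : B -> B) by [].
pose sgn_ok := fun (_ : 'I_N) s => s = false.
pose mdl := fun (_ : 'I_N) s => crossed_graded (idData B s).
have h_uniq i s s' (y : B) : sgn_ok i s -> sgn_ok i s' -> (forall x, x * y = y * x) ->
    y * gen_act idfun i y * (-1) ^+ s' = (-1) ^+ s -> s = s' /\ y * gen_act idfun i y = 1.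
  by move=> -> -> _; rewrite mulr1.
have h_norm i (a : B) : a != 0 -> (forall x, x * a = a * x) -> gen_act idfun i a = a ->
    exists (b : B) s, [/\ forall x, x * b = b * x, sgn_ok i s
      & b * gen_act idfun i b * a = (-1) ^+ s].
  move=> a0 _ _; have [b bb] := Bsqrt a.
  have Ub : b \is a GRing.unit.
    by apply: Bdiv; apply: contraNneq a0 => b0; rewrite -bb b0 mul0r.
  exists b^-1, false; split=> //.
  by rewrite gen_act_idfun -bb -mulrA mulKr // mulVr.
have h_frames D : P D -> exists phi : {lrmorphism B -> D}, [/\ identifies0 phi,
    forall i, exists x, [/\ x \in gcomp D (tnth z i), x != 0
                          & forall d, x * phi d = phi (gen_act idfun i d) * x]
  & forall theta, square_one_gens z theta -> exists s, id_frame phi theta s /\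
      forall i, sgn_ok i (s i)].
  move=> PD; have [phi [phi0 D_comm]] := P_phi PD; exists phi; split=> // [i|theta g].
    exists (vpick (gcomp D (tnth z i))); rewrite memv_pick vpick0.
    split=> //; first by case: (P_div PD) => _; apply.
    move=> d; rewrite gen_act_idfun (D_comm (tnth z i)) ?memv_pick //.
    exact: identifies0_mem.
  by exists (fun=> false); split=> //; apply: square_one_frame.
have h_P D (phi : {lrmorphism B -> D}) theta s : full_division_alg D ->
    id_frame phi theta s -> (forall i, sgn_ok i (s i)) ->
    P D /\ square_one_gens z theta.
  move=> D_div fr s_ok; split; first exact: frame_P fr.
  move=> i; split; first exact: fr_mem fr i.
    exact: id_frame_comm fr i.
  by rewrite (fr_sq fr) s_ok.
have h_mdl D (phi : {lrmorphism B -> D}) theta s i := @id_frame_iso D phi theta s i.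
have h_inj i s s' : sgn_ok i s -> sgn_ok i s' ->
    graded_iso (mdl i s) (mdl i s') -> s = s' by move=> -> ->.
have h_allowed i E : allowed i E <-> exists2 s, sgn_ok i s & graded_iso E (mdl i s).
  rewrite allowedE; split=> [|[s ->]//]; by exists false.
split; first exact: (normal_form idK Bdiv h_norm P_div h_frames h_P h_mdl h_allowed).
exact: (classification z_basis neq1 idK Bdiv h_uniq P_div h_frames h_P h_mdl
  h_inj h_allowed).
Qed.

End SquareRoots.
End IdFrames.

(** * Complex degree zero part *)

(** Left multiplication by x on all of D has an eigenvalue a, with an eigenvector y that may be
    inhomogeneous. If x - a were nonzero it would be invertible, being of degree 0, yet it kills
    y. *)
Lemma closed_degree0 (K : closedFieldType) (G : finZmodType) (D : gradedAlg K G) :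
  graded_division D -> gcomp D 0 = 1%VS.
Proof.
move=> D_div; apply/eqP; rewrite eqEsubv andbC; apply/andP; split.
  by rewrite -memvE gcomp1.
apply/subvP => x Dx; pose e := vbasis {:D}.
have e_basis : basis_of {:D} e := vbasisP _.
pose M := passmx.mxof e e (amull x).
have [a Ma] : exists a, eigenvalue M a.
  have /closed_rootP[a Ma] : size (char_poly M) != 1%N.
    rewrite size_char_poly eqSS dimv_eq0; apply: contraTneq (memvf (1 : D)) => ->.
    by rewrite memv0 oner_eq0.
  by exists a; rewrite eigenvalue_root_char.
have [v vM v0] := eigenvalueP Ma.
pose y : D := passmx.vecof e v.
have y0 : y != 0 by rewrite passmx.vecof_eq0.
have xy : x * y = a *: y.
  have := passmx.hom_vecof e e_basis (amull x) v; rewrite lfunE /= -/M vM => ->.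
  rewrite /y /passmx.vecof scaler_sumr; apply: eq_bigr => i _.
  by rewrite mxE scalerA.
have [/eqP|xa0] := eqVneq (x - a%:A) 0.
  by rewrite subr_eq0 => /eqP->; rewrite memvZ // memv_line.
have /D_div/(_ xa0) Ux : x - a%:A \in gcomp D 0.
  by rewrite memvB // memvZ // gcomp1.
by move: y0; rewrite -(mulKr Ux y) mulrBl xy mulr_algl subrr mulr0 eqxx.
Qed.

Lemma identifies0_alg (K : fieldType) (G : finZmodType) (D : gradedAlg K G) :
  gcomp D 0 = 1%VS -> exists phi : {lrmorphism K^o -> D},
    (forall x, phi x = x%:A) /\ identifies0 phi.
Proof.
move=> D0; have [phi phiE] : exists phi : {lrmorphism K^o -> D}, phi =1 in_alg D.
  apply: lrmorphism_exists => [k x y||x y]; last 2 first.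
  - exact: rmorph1.
  - exact: rmorphM.
  by rewrite /= scalerDl scalerA.
exists phi; split=> //; split=> [|x]; first exact: fmorph_inj.
rewrite D0; split=> [/vlineP[k ->]|[d <-]]; first by exists k; rewrite phiE.
by rewrite phiE memvZ // memv_line.
Qed.

Section ComplexCases.
Variables (R : realType) (N : nat) (z : N.-tuple 'rV['F_2]_N).
Hypothesis z_basis : basis_of fullv z.

Lemma classification_complex :
  let P := fun D : gradedAlg (complex R) 'rV['F_2]_N =>
      full_division_alg D in
  let model := fun (i : 'I_N) (E : gradedAlg (complex R) 'F_2) =>
      graded_iso E (crossed_graded (idData (complex R)^o false)) in
  [/\ forall D, P D -> gcomp D 0 = 1%VS,
      has_normal_form z P (@square_one_gens (complex R) N z) model
    & classified_by z P (@square_one_gens (complex R) N z) model].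
Proof.
move=> P model; pose C := complex R.
have D0 D : P D -> gcomp D 0 = 1%VS.
  by case=> D_div _; apply: (@closed_degree0 C _ D D_div).
have Bdiv (x : C^o) : x != 0 -> x \is a GRing.unit by rewrite -unitfE.
have Bcomm (x y : C^o) : x * y = y * x := mulrC (x : C) y.
have Bsqrt (a : C^o) : exists b : C^o, b * b = a.
  by exists (sqrtc a); rewrite -[RHS]sqr_sqrtc expr2.
have P_phi D : P D -> exists phi : {lrmorphism C^o -> D},
    identifies0 phi /\ homogeneous_commute0 D.
  move=> PD; have [phi [_ phi0]] := identifies0_alg (D0 D PD).
  exists phi; split=> // c x _ d; rewrite (D0 D PD) => /vlineP[k ->].
  by rewrite -scalerAl -scalerAr mul1r mulr1.
have [] := @sqrt_classification C N z z_basis C^o Bdiv Bcomm Bsqrt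
  (numField_neqN1 C) P model (fun=> id) P_phi.
- by [].
- by [].
by move=> nf cl; split.
Qed.

Lemma complexR_div (x : complexR R) : x != 0 -> x \is a GRing.unit.
Proof. by rewrite -(unitfE (x : Rcomplex R)). Qed.

Lemma complexR_comm (x y : complexR R) : x * y = y * x.
Proof. exact: mulrC (x : Rcomplex R) y. Qed.

Lemma complexR_sqrt (a : complexR R) : exists b, b * b = a.
Proof. by exists (sqrtc a); rewrite -[RHS]sqr_sqrtc expr2. Qed.

Lemma classification_complexR :
  let P := fun D : gradedAlg R 'rV['F_2]_N =>
      [/\ full_division_alg D, degree0_is D (complexR R)
        & homogeneous_commute0 D] in
  let model := fun (i : 'I_N) (E : gradedAlg R 'F_2) =>
      graded_iso E (crossed_graded (idData (complexR R) false)) in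
  [/\ has_normal_form z P (@square_one_gens R N z) model,
      forall D, P D ->
          forall phi : {lrmorphism complexR R -> D}, identifies0 phi ->
          forall i : 'I_N,
          exists f : {lrmorphism Z2sub D (tnth z i) ->
                        crossed_graded (idData (complexR R) false)},
            is_graded_iso f /\
            forall (c : complexR R) (x y : Z2sub D (tnth z i)),
              Z2sub_val y = phi c * Z2sub_val x ->
              f y = crossed_in (idData (complexR R) false) c * f x
    & classified_by z P (@square_one_gens R N z) model].
Proof.
move=> P model.
have P_div D : P D -> full_division_alg D by case.
have P_phi D : P D -> exists phi : {lrmorphism complexR R -> D},
    identifies0 phi /\ homogeneous_commute0 D by case=> _ [phi phi0]; exists phi.
have [||nf cl] := sqrt_classification z_basis complexR_div complexR_comm
  complexR_sqrt (numField_neqN1 R) (P := P) (allowed := model) P_div P_phi.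
- move=> D phi theta s D_div fr; split=> //; first by exists phi; apply: fr_id fr.
  exact: (id_frame_commute0 z_basis complexR_div complexR_comm fr).
- by [].
split=> // D PD phi phi0 i.
have [[theta /(square_one_frame phi0) fr] _ _] := nf D PD.
have [f [f_iso fE]] := id_frame_crossed z_basis i fr.
exists f; split=> // c x y yE.
(* Scaling by [phi c] is multiplication by the element [w] of the subalgebra; f is multiplicative
   and sends [w] to c, so it is C-linear. *)
have c_in : phi c \in Z2sub_aspace D (tnth z i).
  by apply: (subvP (addvSl _ _)); apply: identifies0_mem.
pose w : Z2sub D (tnth z i) := Subvs c_in.
have -> : y = w * x by apply: val_inj.
by rewrite rmorphM /= (fE w c).
Qed.

End ComplexCases.

(** * Central degree zero part *)

Section RealSigns.
Variable R : realType.

(** The positivity behind the rigidity of signs: r will be the square of a real number or the norm y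
    conj(y) of a complex one. *)
Lemma ge0_sign (r : R) (s s' : bool) : 0 <= r -> r * (-1) ^+ s' = (-1) ^+ s ->
  s = s' /\ r = 1.
Proof.
move=> r0; case: s s' => [] []; rewrite ?expr0 ?expr1 ?mulr1 ?mulrN1 => E.
- by split=> //; apply: oppr_inj.
- by move: r0; rewrite E oppr_ge0 ler10.
- by move: r0; rewrite -oppr_le0 E ler10.
- by [].
Qed.

Lemma real_normalise (k : R) : k != 0 -> exists (r : R) (s : bool), r * r * k = (-1) ^+ s.
Proof.
move=> k0; exists (Num.sqrt `|k|)^-1, (k < 0).
rewrite -invfM -expr2 sqr_sqrtr // {2}[k]realEsign ?num_real // mulrCA mulVf ?mulr1 //.
by rewrite normr_eq0.
Qed.

End RealSigns.

Definition real_scalars (R : realType) (B : falgType R) : Prop :=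
  forall b : B, exists k : R, b = k%:A.

Definition quaternion_basis (R : realType) (B : falgType R) (I J : B) : Prop :=
  [/\ I * I = -1, J * J = -1, J * I = - (I * J)
    & forall b : B, exists k : 'I_4 -> R,
        b = (k 0)%:A + k 1 *: I + k 2 *: J + k 3 *: (I * J)].

(** As u^-1 = - u, the element x - u x u is x + u x u^-1, the sum over the group of order two
    generated by conjugation by u. *)
Lemma average_commute (A : nzRingType) (u x : A) : u * u = -1 ->
  (x - u * x * u) * u = u * (x - u * x * u).
Proof.
move=> uu; have -> : x - u * x * u = x - u * (x * u) by rewrite mulrA.
rewrite mulrBl mulrBr -!mulrA uu mulrN1 mulrN opprK [u * (u * _)]mulrA uu.
by rewrite mulN1r opprK addrC.
Qed.

(** Passing v through u x u changes the sign twice, so averaging over u keeps the commutation with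
    v. *)
Lemma average_anticommute (A : nzRingType) (u v x : A) :
  u * v = - (v * u) -> x * v = v * x ->
  (x - u * x * u) * v = v * (x - u * x * u).
Proof.
move=> uv xv; rewrite mulrBl mulrBr xv; congr (_ - _).
rewrite -(mulrA (u * x)) uv mulrN (mulrA (u * x)) -(mulrA u x) xv (mulrA u v) uv.
by rewrite !mulNr opprK !mulrA.
Qed.

Section CentralReal.
Variables (R : realType) (N : nat) (z : N.-tuple 'rV['F_2]_N).
Hypothesis z_basis : basis_of fullv z.
Variable B : falgType R.
Hypothesis Bdiv : forall x : B, x != 0 -> x \is a GRing.unit.
Hypothesis Bcentral : forall a : B, (forall x, x * a = a * x) -> exists k : R, a = k%:A.
Hypothesis Bquat : real_scalars B \/ exists I J : B, quaternion_basis I J.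

(* Let i, j in D_0 be anticommuting square roots of -1. Then x - i x i commutes *)
(* with i; if it vanishes, x anticommutes with i and x j commutes with i. The  *)
(* same step for j preserves commutation with i.                               *)
Lemma commuting_element (D : gradedAlg R 'rV['F_2]_N) (phi : {lrmorphism B -> D}) c :
  full_division_alg D -> identifies0 phi ->
  exists x, [/\ x \in gcomp D c, x != 0 & forall d, x * phi d = phi d * x].
Proof.
case=> D_div D_supp phi0; have [phi_inj D0] := phi0.
have Dx0 := memv_pick (gcomp D c); have := D_supp c; rewrite -vpick0.
move: (vpick _) Dx0 => x Dx x0.
case: Bquat => [Bscal|[I [J [II JJ JI Bspan]]]].
  exists x; split=> // d; have [k ->] := Bscal d.
  by rewrite linearZ /= rmorph1 -scalerAl -scalerAr mul1r mulr1.
pose i := phi I; pose j := phi J.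
have ii : i * i = -1 by rewrite -rmorphM II rmorphN1.
have jj : j * j = -1 by rewrite -rmorphM JJ rmorphN1.
have ji : j * i = - (i * j) by rewrite -!rmorphM JI rmorphN.
have Di : i \in gcomp D 0 by apply: identifies0_mem.
have Dj : j \in gcomp D 0 by apply: identifies0_mem.
have memM (y d : D) : y \in gcomp D c -> d \in gcomp D 0 -> y * d \in gcomp D c.
  by move=> Dy Dd; rewrite -[c]addr0 gcompM.
have Mmem (y d : D) : y \in gcomp D c -> d \in gcomp D 0 -> d * y \in gcomp D c.
  by move=> Dy Dd; rewrite -[c]add0r gcompM.
have unit_i : i \is a GRing.unit.
  by apply/unitrP; exists (- i); rewrite mulNr mulrN ii opprK.
have unit_j : j \is a GRing.unit.
  by apply/unitrP; exists (- j); rewrite mulNr mulrN jj opprK.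
have [y [Dy y0 yi]] : exists y, [/\ y \in gcomp D c, y != 0 & y * i = i * y].
  have [xi|xi] := eqVneq (x - i * x * i) 0; last first.
    exists (x - i * x * i); split=> //; first by rewrite memvB // memM // Mmem.
    exact: average_commute.
  exists (x * j); split; first exact: memM.
    by rewrite -(inj_eq (mulIr unit_j)) mul0r in x0.
  have ix : i * x = - (x * i).
    move/eqP: xi; rewrite subr_eq0 => /eqP/(congr1 ( *%R^~ i)).
    by rewrite -!mulrA ii mulrN1 mulrN => ->; rewrite opprK.
  by rewrite [RHS]mulrA ix mulNr -!mulrA ji mulrN.
have [w [Dw w0 wi wj]] : exists w,
    [/\ w \in gcomp D c, w != 0, w * i = i * w & w * j = j * w].
  have [xj|xj] := eqVneq (y - j * y * j) 0; last first.
    exists (y - j * y * j); split=> //; first by rewrite memvB // memM // Mmem.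
      exact: average_anticommute.
    exact: average_commute.
  exists (y * i); split; first exact: memM.
  - by rewrite -(inj_eq (mulIr unit_i)) mul0r in y0.
  - by rewrite yi -mulrA yi.
  have jy : j * y = - (y * j).
    move/eqP: xj; rewrite subr_eq0 => /eqP/(congr1 ( *%R^~ j)).
    by rewrite -!mulrA jj mulrN1 mulrN => ->; rewrite opprK.
  by rewrite [RHS]mulrA jy mulNr -!mulrA ji mulrN opprK.
exists w; split=> // d; have [k ->] := Bspan d.
rewrite !linearD !linearZ /= rmorph1 rmorphM /= -/i -/j.
rewrite !(mulrDl, mulrDr) -!scalerAl -!scalerAr mul1r mulr1 wi wj.
by rewrite [w * _]mulrA wi -!mulrA wj.
Qed.

Lemma alg_inj (k l : R) : k%:A = l%:A :> B -> k = l.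
Proof. exact: (fmorph_inj (in_alg B)). Qed.

Lemma central_sqr_sign (y : B) (s s' : bool) : (forall x, x * y = y * x) ->
  y * y * (-1) ^+ s' = (-1) ^+ s -> s = s' /\ y * y = 1.
Proof.
move=> /Bcentral[k ->]; rewrite -!(rmorph_sign (in_alg B)) -!(rmorphM (in_alg B)).
move=> /alg_inj/ge0_sign[|-> /= kk]; first exact: sqr_ge0.
by rewrite kk scale1r.
Qed.

Lemma classification_central :
  let P := fun D : gradedAlg R 'rV['F_2]_N =>
      full_division_alg D /\ degree0_is D B in
  let model := fun (i : 'I_N) (E : gradedAlg R 'F_2) =>
      exists s : bool, graded_iso E (crossed_graded (idData B s)) in
  has_normal_form z P (@square_sign_gens R N z) model /\
  classified_by z P (@square_sign_gens R N z) model.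
Proof.
move=> P model.
have idK : involutive (idfun : B -> B) by [].
pose sgn_ok := fun (_ : 'I_N) (_ : bool) => True.
pose mdl := fun (_ : 'I_N) s => crossed_graded (idData B s).
have h_uniq i s s' (y : B) : sgn_ok i s -> sgn_ok i s' -> (forall x, x * y = y * x) ->
    y * gen_act idfun i y * (-1) ^+ s' = (-1) ^+ s -> s = s' /\ y * gen_act idfun i y = 1.
  by move=> _ _ yC; rewrite gen_act_idfun; apply: central_sqr_sign.
have h_norm i (a : B) : a != 0 -> (forall x, x * a = a * x) -> gen_act idfun i a = a ->
    exists (b : B) s, [/\ forall x, x * b = b * x, sgn_ok i s
      & b * gen_act idfun i b * a = (-1) ^+ s].
  move=> a0 /Bcentral[k aE] _.
  have [|r [s rs]] := @real_normalise R k.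
    by apply: contraNneq a0 => k0; rewrite aE k0 scale0r.
  exists r%:A, s; split=> // [x|]; first by rewrite -scalerAl -scalerAr mul1r mulr1.
  by rewrite gen_act_idfun aE -scalerAl mul1r -!scalerAl mul1r !scalerA rs
    scaler_sign; case: s {rs}.
have P_div D : P D -> full_division_alg D by case.
have h_frames D : P D -> exists phi : {lrmorphism B -> D}, [/\ identifies0 phi,
    forall i, exists x, [/\ x \in gcomp D (tnth z i), x != 0
                          & forall d, x * phi d = phi (gen_act idfun i d) * x]
  & forall theta, square_sign_gens z theta ->
      exists s, frame z idfun phi theta s /\ forall i, sgn_ok i (s i)].
  case=> D_div [phi phi0]; exists phi; split=> // [i|theta g].
    have [x [Dx x0 xC]] := commuting_element (tnth z i) D_div phi0.
    by exists x; split=> // d; rewrite gen_act_idfun xC.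
  exists (fun i => theta i ^+ 2 != 1); split=> //; split=> // [i|i x|i].
  - by case: (g i).
  - by have [_ th_comm _] := g i; rewrite gen_act_idfun th_comm // identifies0_mem.
  have [_ _ [->|E]] := g i; first by rewrite eqxx.
  by rewrite E; case: eqVneq => // ->.
have h_P (D : gradedAlg R 'rV['F_2]_N) (phi : {lrmorphism B -> D}) theta s :
    full_division_alg D ->
    frame z idfun phi theta s -> (forall i, sgn_ok i (s i)) ->
    P D /\ square_sign_gens z theta.
  move=> D_div fr _; split; first by split=> //; exists phi; apply: fr_id fr.
  move=> i; split; first exact: fr_mem fr i.
    exact: id_frame_comm fr i.
  by rewrite (fr_sq fr); case: (s i); [right|left].
have h_mdl (D : gradedAlg R 'rV['F_2]_N) (phi : {lrmorphism B -> D}) theta s i :=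
  @id_frame_iso R N z z_basis B D phi theta s i.
have h_inj i s s' : sgn_ok i s -> sgn_ok i s' ->
    graded_iso (mdl i s) (mdl i s') -> s = s'.
  move=> _ _ /crossed_iso_sq/(_ (erefl _))[y yE yC].
  by have [] := central_sqr_sign (yC (fun=> erefl) (fun=> erefl)) yE.
have h_allowed i E : model i E <-> exists2 s, sgn_ok i s & graded_iso E (mdl i s).
  by split=> [[s]|[s _]]; exists s.
split; first exact: (normal_form idK Bdiv h_norm P_div h_frames h_P h_mdl h_allowed).
exact: (classification z_basis (numField_neqN1 R) idK Bdiv h_uniq P_div h_frames
  h_P h_mdl h_inj h_allowed).
Qed.

End CentralReal.

(** What case (2) uses of R and H, in a form that transports along isomorphisms, because D_0 is
    given only up to isomorphism. *)
Definition central_real_division (R : realType) (B : falgType R) : Prop :=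
  [/\ forall x : B, x != 0 -> x \is a GRing.unit,
      forall a : B, (forall x, x * a = a * x) -> exists k : R, a = k%:A
    & real_scalars B \/ exists I J : B, quaternion_basis I J].

Lemma central_real_division_iso (R : realType) (A B : falgType R) :
  alg_iso A B -> central_real_division B -> central_real_division A.
Proof.
case=> f f_bij [Bdiv Bcentral Bquat]; have [g fK gK] := lrmorphism_inv f_bij.
have gZ k : g k%:A = k%:A by rewrite linearZ /= rmorph1.
split=> [x x0|a aC|].
- rewrite -(fK x) rmorph_unit // Bdiv // -(inj_eq (can_inj gK)) rmorph0 fK //.
- have [x|k fa] := Bcentral (f a); last by exists k; rewrite -(fK a) fa gZ.
  by rewrite -(gK x) -!rmorphM aC.
case: Bquat => [Bscal|[I [J [II JJ JI Bspan]]]].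
  by left=> b; have [k fb] := Bscal (f b); exists k; rewrite -(fK b) fb gZ.
right; exists (g I), (g J); split.
- by rewrite -rmorphM II rmorphN1.
- by rewrite -rmorphM JJ rmorphN1.
- by rewrite -!rmorphM JI rmorphN.
move=> b; have [k fb] := Bspan (f b); exists k.
by rewrite -(fK b) fb !linearD !linearZ /= rmorph1 rmorphM.
Qed.

Lemma real_central_division (R : realType) : central_real_division (R^o : falgType R).
Proof.
split=> [x|a _|]; first by rewrite -(unitfE (x : R)).
  by exists a; rewrite [RHS]mulr1.
by left=> b; exists b; rewrite [RHS]mulr1.
Qed.

(** * Complex conjugation and the quaternion algebra *)

Section Quaternions.
Variable R : realType.
Local Notation C := (complexR R).
Local Notation H := (quaternions R).

Lemma complexR_alg (r : R) : r%:A = Complex r 0 :> C.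
Proof. by congr Complex; rewrite ?mulr1 ?mulr0. Qed.

Lemma complexR_conj_mul (x : C) : exists2 r : R, 0 <= r &
  x * conjR R x = r%:A /\ (r = 0 -> x = 0).
Proof.
case: x => a b; exists (a * a + b * b); first by rewrite addr_ge0 -?expr2 ?sqr_ge0.
split.
  rewrite complexR_alg; congr Complex; first by rewrite mulrN opprK.
  by rewrite mulrN mulrC addNr.
move/eqP; rewrite paddr_eq0 -?expr2 ?sqr_ge0 // !sqrf_eq0 => /andP[/eqP-> /eqP->].
by [].
Qed.

Lemma complexR_conj_fixed (x : C) : conjR R x = x -> exists k : R, x = k%:A.
Proof.
case: x => a b [] /esym/eqP; rewrite -subr_eq0 opprK -mulr2n mulrn_eq0 /= => /eqP->.
by exists a; rewrite complexR_alg.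
Qed.

Definition imagR : C := Complex 0 1.

Lemma imagR_sq : imagR * imagR = -1.
Proof. by congr Complex; rewrite ?mul0r ?mul1r ?mulr0 ?mulr1 ?addr0 ?sub0r ?oppr0. Qed.

Lemma conj_imagR : conjR R imagR = - imagR.
Proof. by congr Complex; rewrite oppr0. Qed.

Lemma complexR_imag (x : C) : exists a b : R, x = a%:A + b *: imagR.
Proof.
case: x => a b; exists a, b; rewrite complexR_alg.
by congr Complex; rewrite ?mulr0 ?mulr1 ?addr0 ?add0r.
Qed.

Lemma imagR_eq0 (x : C) : imagR * x = - (imagR * x) -> x = 0.
Proof.
move=> E; have /eqP : (imagR * x) *+ 2 = 0 by rewrite mulr2n {1}E addNr.
rewrite -scaler_nat scaler_eq0 pnatr_eq0 /= => /eqP/(congr1 ( *%R imagR)).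
by rewrite mulrA imagR_sq mulN1r mulr0 => /eqP; rewrite oppr_eq0 => /eqP.
Qed.

Lemma quaternions_div (u : H) : u != 0 -> u \is a GRing.unit.
Proof.
case: u => x y u0; have [r r0 [xr x_eq0]] := complexR_conj_mul x.
have [s s0 [ys y_eq0]] := complexR_conj_mul y.
have rs : r + s != 0.
  rewrite paddr_eq0 //; apply: contra_neqN u0 => /andP[/eqP/x_eq0-> /eqP/y_eq0->].
  by [].
(* The quaternion conjugate of x + y j; its product with u, in either order, is the norm |x|^2 +
   |y|^2 = r + s. *)
pose v := @Crossed R (conjData R true) (conjR R x) (- y).
have E (w : crossed (conjData R true)) :
    w = @Crossed R (conjData R true) (r + s)%:A 0 -> (r + s)^-1 *: w = 1.
  by move=> ->; apply: crossed_eq; rewrite /= ?scaler0 // scalerA mulVf // scale1r.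
have xK : conjR R (conjR R x) = x := conjcK x.
apply/unitrP; exists ((r + s)^-1 *: v : crossed _); split.
  rewrite -scalerAl; apply: E; apply: crossed_eq => /=.
    by rewrite complexR_comm xr expr1 mulrN1 mulNr opprK ys -scalerDl.
  by rewrite mulNr (complexR_comm y) subrr.
rewrite -scalerAr; apply: E; apply: crossed_eq => /=.
  by rewrite xr expr1 mulrN1 rmorphN mulrN opprK ys -scalerDl.
by rewrite xK mulrN (complexR_comm y) addNr.
Qed.

(** For a central x + y j, commuting with i forces y = 0, and commuting with j then forces conj(x) =
    x, so x is real. *)
Lemma quaternions_central_division : central_real_division H.
Proof.
split; first exact: quaternions_div.
  case=> x y aC.
  have : imagR * y + 0 * conjR R x = x * 0 + y * conjR R imagR.
    exact: (congr1 (@crossed_snd R (conjData R true))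
      (aC (@Crossed R (conjData R true) imagR 0))).
  rewrite conj_imagR mul0r mulr0 addr0 add0r mulrN (complexR_comm y).
  move=> /imagR_eq0 y0.
  have : 0 * y + 1 * conjR R x = x * 1 + y * conjR R 0.
    exact: (congr1 (@crossed_snd R (conjData R true))
      (aC (@Crossed R (conjData R true) 0 1))).
  rewrite y0 !mul0r mul1r mulr1 addr0 add0r.
  case/complexR_conj_fixed => k xk; exists k.
  by rewrite xk; apply: crossed_eq; rewrite /= ?scaler0.
right; exists (@Crossed R (conjData R true) imagR 0).
exists (@Crossed R (conjData R true) 0 1); split.
- apply: crossed_eq; rewrite /= ?oppr0 ?mulr0 ?mul0r ?addr0 //.
  exact: imagR_sq.
- by apply: crossed_eq; rewrite /= ?oppr0 ?mulr0 ?mul0r ?addr0 ?add0r ?rmorph1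
    ?mul1r ?rmorph0.
- apply: crossed_eq;
    rewrite /= ?(mulr0, mul0r, addr0, add0r, mul1r, mulr1, rmorph0, oppr0) //.
  exact: conj_imagR.
case=> x y; have [a [b ->]] := complexR_imag x; have [c [d ->]] := complexR_imag y.
exists (fun i => nth 0 [:: a; b; c; d] i).
apply: crossed_eq => /=.
  by rewrite !(mulr0, mul0r, scaler0, addr0).
by rewrite !(mulr0, mul0r, scaler0, addr0, add0r, mulr1).
Qed.

End Quaternions.

(** * Complex conjugation *)

Section ConjugationCase.
Variables (R : realType) (N : nat).
Local Notation C := (complexR R).
Local Notation V := 'rV['F_2]_N.
Implicit Type D : gradedAlg R V.
Local Notation imag := (imagR R).

Let noncentral := fun D : gradedAlg R V =>
  [/\ full_division_alg D, degree0_is D C & ~ homogeneous_commute0 D].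

Lemma conjRK : involutive (conjR R).
Proof. exact: conjcK. Qed.

Lemma conjR_imag (a b : R) : conjR R (a%:A + b *: imag) = a%:A + b *: - imag.
Proof.
have conjD u v : conjR R (u + v) = conjR R u + conjR R v by exact: rmorphD.
have conjZ k u : conjR R (k *: u) = k *: conjR R u by exact: linearZ.
have conj1 : conjR R 1 = 1 by exact: rmorph1.
by rewrite conjD !conjZ conj_imagR conj1.
Qed.

Lemma imagR_neqN : imag != - imag.
Proof.
apply/eqP => E; have [] : imag <> 0 by case=> /eqP; rewrite oner_eq0.
have : imag * 1 = - (imag * 1) by rewrite !mulr1.
by move/imagR_eq0/eqP; rewrite oner_eq0.
Qed.

Lemma sqrN1_imagR (m : C) : m * m = -1 -> m = imag \/ m = - imag.
Proof.
move=> mm; have [/eqP|m0] := eqVneq (m - imag) 0; first by rewrite subr_eq0 => /eqP; left.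
right; apply/eqP; rewrite -addr_eq0; apply/eqP.
have : (m - imag) * (m + imag) = 0.
  rewrite mulrBl !mulrDr mm imagR_sq (complexR_comm m imag).
  by rewrite [imag * m + _]addrC subrr.
by move/(congr1 ( *%R (m - imag)^-1)); rewrite mulKr ?complexR_div // mulr0.
Qed.

Section Action.
Variables (D : gradedAlg R V) (phi : {lrmorphism C -> D}).
Hypotheses (D_fd : full_division_alg D) (phi0 : identifies0 phi).

Lemma degree0_div c x y : x \in gcomp D c -> x != 0 -> y \in gcomp D c ->
  exists a, y = phi a * x.
Proof.
move=> Dx x0 Dy; have [D_div _] := D_fd; have [_ D0] := phi0.
have Ux := D_div _ _ Dx x0.
have Dxx : x * x \in gcomp D 0 by rewrite -(F2_addrr c) gcompM.
have [b bE] := (D0 _).1 Dxx.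
have b0 : b != 0.
  apply/eqP => b0; move/eqP: x0; apply; apply: (mulIr Ux).
  by rewrite mul0r -bE b0 rmorph0.
have [e eE] : exists e, phi e = y * x.
  by apply/D0; rewrite -(F2_addrr c) gcompM.
have xV : x * phi b^-1 * x = 1.
  apply: (mulrI Ux); rewrite mulr1 !mulrA -bE -rmorphM mulrV ?complexR_div //.
  by rewrite rmorph1 mul1r.
have xbC : x * phi b = phi b * x by rewrite bE mulrA.
(* With b = x^2 and e = y x, this is y = (y x) x^-1 and x^-1 = b^-1 x. *)
exists (e * b^-1); rewrite rmorphM /= eE -[LHS]mulr1 -xV !mulrA; congr (_ * _ * _).
Qed.

(** Conjugation by x sends the imaginary unit to some m in C with m^2 = -1, so m = i or m = -i, and
    R-linearity determines the rest. Other elements of D_c are C-multiples of x and act alike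
    because C is commutative. *)
Lemma conj_or_id c : exists chi : bool,
  forall x, x \in gcomp D c ->
    forall d, x * phi d = phi (if chi then conjR R d else d) * x.
Proof.
have [_ D_supp] := D_fd; have [phi_inj D0] := phi0.
have Dx0 := memv_pick (gcomp D c); have := D_supp c; rewrite -vpick0.
move: (vpick _) Dx0 => x Dx x0; have [D_div _] := D_fd.
have Ux := D_div _ _ Dx x0.
have [m mE] : exists m, x * phi imag = phi m * x.
  by apply: (degree0_div Dx x0); rewrite -[c]addr0 gcompM // identifies0_mem.
have mm : m * m = -1.
  apply: phi_inj; apply: (mulIr Ux); rewrite rmorphM -mulrA -mE mulrA -mE -mulrA.
  by rewrite -rmorphM imagR_sq !rmorphN1 mulrN1 mulN1r.
exists (m == - imag) => y /(degree0_div Dx x0)[e ->] d.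
have xd : x * phi d = phi (if m == - imag then conjR R d else d) * x.
  have [a [b ->]] := complexR_imag d.
  have -> : (if m == - imag then conjR R (a%:A + b *: imag) else a%:A + b *: imag) =
      a%:A + b *: m.
    case: (sqrN1_imagR mm) => ->; first by rewrite (negPf imagR_neqN).
    by rewrite eqxx conjR_imag.
  have phiE u : phi (a%:A + b *: u) = a%:A + b *: phi u.
    by rewrite linearD !linearZ /= rmorph1.
  rewrite !phiE mulrDl mulrDr -!scalerAl -!scalerAr mE mulr1 mul1r.
  by rewrite scalerAl.
by rewrite -mulrA xd mulrA [RHS]mulrA -!rmorphM complexR_comm.
Qed.

End Action.

(** The type of action is a character of the grading group to Z/2, nontrivial because D is
    noncentral. A vector v with value 1, followed by a basis of the kernel, is adapted. *)
Lemma adapted_basis D : noncentral D ->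
  exists z : N.-tuple V, basis_of fullv z /\ adapted D z.
Proof.
move=> [D_fd [phi phi0] D_nc]; have [D_div D_supp] := D_fd.
have [phi_inj D0] := phi0.
have [chi chiP] := fin_all_exists (conj_or_id D_fd phi0).
have phi_neq x : x \is a GRing.unit -> phi imag * x <> phi (- imag) * x.
  by move=> Ux /(mulIr Ux)/phi_inj/eqP; rewrite (negPf imagR_neqN).
have chi_uniq c (x : D) (b : bool) : x \in gcomp D c -> x != 0 ->
    (forall d, x * phi d = phi (if b then conjR R d else d) * x) -> chi c = b.
  move=> Dx x0 xb; have := xb imag; rewrite (chiP c x Dx).
  have ne := phi_neq x (D_div _ _ Dx x0).
  by case: (chi c) b {xb} => [] [] //; rewrite conj_imagR; [move/esym/ne|move/ne].
have chiD a b : chi (a + b) = chi a (+) chi b.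
  have Da := memv_pick (gcomp D a); have Db := memv_pick (gcomp D b).
  have := D_supp b; have := D_supp a; rewrite -!vpick0 => a0 b0.
  apply: chi_uniq (gcompM Da Db) _ _.
    have Ua := D_div _ _ Da a0.
    by rewrite -(inj_eq (mulrI Ua)) mulr0 in b0.
  move=> d; rewrite -mulrA (chiP b _ Db) [LHS]mulrA (chiP a _ Da) -mulrA.
  congr (phi _ * _).
  by case: (chi a); case: (chi b); rewrite //= conjRK.
have [v v1] : exists v, chi v.
  apply/existsP/negbNE; rewrite negb_exists; apply/negP => /forallP chi0.
  apply: D_nc => c x Dx d /D0[e <-].
  by rewrite (chiP c) // (negPf (chi0 c)).
(* The character becomes a linear form over F_2, so that its kernel is a subspace with a basis. *)
pose L0 (c : V) : ('F_2)^o := (chi c)%:R.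
have chi0 : chi 0 = false by have := chiD 0 0; rewrite addr0 addbb.
have L0_lin : linear L0.
  move=> k a b; rewrite /L0 chiD; case: k => [[|[|k]]] // lt_k.
    rewrite (_ : Ordinal lt_k = 0) ?scale0r ?chi0 ?add0r //; exact: val_inj.
  rewrite (_ : Ordinal lt_k = 1) ?scale1r; last exact: val_inj.
  by case: (chi a); case: (chi b); apply: val_inj.
pose mL := GRing.isLinear.Build 'F_2 V ('F_2)^o *:%R L0 L0_lin.
pose L : {linear V -> ('F_2)^o} := HB.pack L0 mL.
have LE c : linfun L c = (chi c)%:R by rewrite lfunE.
pose ker := lker (linfun L).
have kerP c : (c \in ker) = ~~ chi c.
  by rewrite memv_ker LE; case: (chi c).
pose s := v :: vbasis ker.
have s_basis : basis_of fullv s.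
  rewrite basisEdim; apply/andP; split.
    apply/subvP => c _; rewrite span_cons (span_basis (vbasisP _)).
    case c1: (chi c); last by apply: (subvP (addvSr _ _)); rewrite kerP c1.
    have -> : c = v + (c + v) by rewrite addrCA F2_addrr addr0.
    by rewrite memv_add ?memv_line // kerP chiD c1 v1.
  (* The family spans, so it remains to bound its length dim ker + 1; the kernel is proper because
     it misses v. *)
  rewrite /= size_tuple ltn_neqAle dimvS ?subvf // andbT.
  apply: contraL v1 => /eqP dimE; rewrite -kerP.
  have -> : ker = fullv by apply/eqP; rewrite eqEdim subvf dimE leqnn.
  exact: memvf.
have s_size : size s == N.
  have := size_basis (X := in_tuple s) s_basis.
  by rewrite dimvf /dim /= mul1n => <-.
exists (Tuple s_size); split=> //; exists phi; split=> // i x Dx x0 d.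
rewrite (chiP _ _ Dx) -mulrA divrr ?(D_div _ _ Dx) // mulr1; congr (phi _).
rewrite (tnth_nth 0) /=; case: i {Dx} => [[|i] lt_i] /=; first by rewrite v1.
have : (vbasis ker)`_i \in ker.
  apply/vbasis_mem/mem_nth; rewrite size_tuple.
  by have := lt_i; rewrite -[X in (_ < X)%N](eqP s_size) /= size_tuple.
by rewrite kerP => /negPf->.
Qed.

Section Adapted.
Variable z : N.-tuple V.
Hypothesis z_basis : basis_of fullv z.
Hypothesis N_gt0 : (0 < N)%N.

Lemma classification_conj :
  let P := fun D => noncentral D /\ adapted D z in
  let model := fun (i : 'I_N) (E : gradedAlg R 'F_2) =>
        if i == 0%N :> nat
        then exists s : bool, graded_iso E (crossed_graded (conjData R s))
        else graded_iso E (crossed_graded (idData (complexR R) false)) in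
  has_normal_form z P (@conj_gens R N z) model /\
  classified_by z P (@conj_gens R N z) model.
Proof.
move=> P model.
pose sgn_ok (i : 'I_N) (s : bool) : Prop := (i == 0%N :> nat) || (s == false).
pose mdl (i : 'I_N) s := if i == 0%N :> nat then crossed_graded (conjData R s)
  else crossed_graded (idData C s).
have gen_actE (i : 'I_N) d :
    gen_act (conjR R) i d = if i == 0%N :> nat then conjR R d else d.
  by rewrite /gen_act; case: ifP.
have conj_sign (y : C) (s s' : bool) : y * conjR R y * (-1) ^+ s' = (-1) ^+ s ->
    s = s' /\ y * conjR R y = 1.
  have [r r0 [-> _]] := complexR_conj_mul y.
  rewrite -!(rmorph_sign (in_alg C)) -(rmorphM (in_alg C)) =>
    /alg_inj/(ge0_sign r0)[-> ->].
  by rewrite scale1r.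
have h_uniq i s s' (y : C) : sgn_ok i s -> sgn_ok i s' -> (forall x, x * y = y * x) ->
    y * gen_act (conjR R) i y * (-1) ^+ s' = (-1) ^+ s ->
    s = s' /\ y * gen_act (conjR R) i y = 1.
  rewrite /sgn_ok gen_actE; case: ifP => [_ _ _ _|_ /eqP-> /eqP-> _].
    exact: conj_sign.
  by rewrite mulr1.
have h_norm i (a : C) : a != 0 -> (forall x, x * a = a * x) ->
    gen_act (conjR R) i a = a ->
    exists (b : C) s, [/\ forall x, x * b = b * x, sgn_ok i s
      & b * gen_act (conjR R) i b * a = (-1) ^+ s].
  (* For the first generator, the square is fixed by conjugation, hence real, and norms only rescale
     it by positive numbers: both signs remain. For the others a complex square root gives 1. *)
  move=> a0 _; rewrite /sgn_ok gen_actE; case: ifP => i0.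
    case/complexR_conj_fixed => k aE.
    have [|r [s rs]] := @real_normalise R k.
      by apply: contraNneq a0 => k0; rewrite aE k0 scale0r.
    exists r%:A, s; split=> // [x|]; first exact: complexR_comm.
    have -> : gen_act (conjR R) i r%:A = r%:A.
      by rewrite linearZ /= rmorph1.
    by rewrite aE -scalerAl mul1r -!scalerAl mul1r !scalerA rs scaler_sign; case: s {rs}.
  move=> _; have [b bb] := complexR_sqrt a.
  have Ub : b \is a GRing.unit.
    by apply: complexR_div; apply: contraNneq a0 => b0; rewrite -bb b0 mul0r.
  exists b^-1, false; split=> // [x|]; first exact: complexR_comm.
  by rewrite gen_actE i0 -bb -mulrA mulKr // mulVr.
have P_div D : P D -> full_division_alg D by case=> [[]].
have h_frames D : P D -> exists phi : {lrmorphism C -> D}, [/\ identifies0 phi,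
    forall i, exists x, [/\ x \in gcomp D (tnth z i), x != 0
                          & forall d, x * phi d = phi (gen_act (conjR R) i d) * x]
  & forall theta, conj_gens z theta ->
      exists s, frame z (conjR R) phi theta s /\ forall i, sgn_ok i (s i)].
  case=> [[D_fd _ _] [phi [phi0 phiP]]]; have [D_div D_supp] := D_fd.
  have xC i x : x \in gcomp D (tnth z i) -> x != 0 ->
      forall d, x * phi d = phi (gen_act (conjR R) i d) * x.
    move=> Dx x0 d; rewrite gen_actE -(phiP i x) //.
    by rewrite -mulrA mulVr ?mulr1 // (D_div _ _ Dx).
  exists phi; split=> // [i|theta g].
    exists (vpick (gcomp D (tnth z i))); have Dx := memv_pick (gcomp D (tnth z i)).
    by split=> //; [rewrite vpick0 | apply: xC; rewrite ?vpick0].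
  have g2 i : theta i ^+ 2 = 1 \/ theta i ^+ 2 = -1.
    by have [_] := g i; case: ifP => // _ ->; left.
  have th0 i : theta i != 0.
    apply/eqP => th0; have := g2 i; rewrite th0 expr0n /=.
    by case=> /eqP; rewrite eq_sym ?oppr_eq0 oner_eq0.
  exists (fun i => theta i ^+ 2 != 1); split; last first.
    by move=> i; rewrite /sgn_ok; have [_] := g i; case: ifP => // _ ->; rewrite eqxx.
  split=> // [i|i x|i]; first by case: (g i).
    exact: xC (proj1 (g i)) (th0 i) x.
  have [->|E] := g2 i; first by rewrite eqxx.
  by rewrite E; case: eqVneq => // ->.
have h_P D (phi : {lrmorphism C -> D}) theta s : full_division_alg D ->
    frame z (conjR R) phi theta s -> (forall i, sgn_ok i (s i)) ->
    P D /\ conj_gens z theta.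
  move=> D_fd fr s_ok; split; last first.
    move=> i; split; first exact: fr_mem fr i.
    have := s_ok i; rewrite (fr_sq fr) /sgn_ok; case: ifP => [_ _|_ /eqP->//].
    by case: (s i); [right|left].
  split; last first.
    exists phi; split=> [|i x Dx x0 d]; first exact: fr_id fr.
    (* Every nonzero x of degree z_i is y theta_i with y in C, so it acts on C exactly as theta_i
       does. *)
    have [y xE] := frame_homog fr Dx; have [D_div _] := D_fd.
    rewrite -gen_actE; apply: (mulIr (D_div _ _ Dx x0)).
    rewrite mulrVK ?(D_div _ _ Dx) // xE -mulrA (fr_comm fr) !mulrA -!rmorphM.
    by rewrite complexR_comm.
  split=> //; first by exists phi; apply: fr_id fr.
  (* The first generator, available since N > 0, witnesses noncentrality: commuting with D_0 would
     give i = -i. *)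
  move=> D_comm; pose i0 := Ordinal N_gt0.
  have [phi_inj _] := fr_id fr.
  have := D_comm _ _ (fr_mem fr i0) (phi imag) (identifies0_mem _ (fr_id fr)).
  have i0_imag : gen_act (conjR R) i0 imag = - imag by rewrite gen_actE -conj_imagR.
  rewrite (fr_comm fr) i0_imag => /(frame_rreg fr)/phi_inj/eqP.
  by rewrite eq_sym (negPf imagR_neqN).
have h_mdl D (phi : {lrmorphism C -> D}) theta s i :
    frame z (conjR R) phi theta s -> graded_iso (Z2sub D (tnth z i)) (mdl i (s i)).
  move=> fr; rewrite /mdl; case: ifP => i0.
    have [||f [f_iso _]] := @Z2sub_crossed R N D (tnth z i) (conjData R (s i)) phi
      (theta i) (fr_id fr) (basis_neq0 z_basis i) (fr_mem fr i).
    - by move=> x; rewrite (fr_comm fr) gen_actE i0.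
    - by rewrite (fr_sq fr) rmorph_sign.
    by exists f.
  have [||f [f_iso _]] := @Z2sub_crossed R N D (tnth z i) (idData C (s i)) phi
    (theta i) (fr_id fr) (basis_neq0 z_basis i) (fr_mem fr i).
  - by move=> x; rewrite (fr_comm fr) gen_actE i0.
  - by rewrite (fr_sq fr) rmorph_sign.
  by exists f.
have h_inj i s s' : sgn_ok i s -> sgn_ok i s' ->
    graded_iso (mdl i s) (mdl i s') -> s = s'.
  rewrite /sgn_ok /mdl; case: ifP => _; last by move=> /eqP-> /eqP->.
  by move=> _ _ /crossed_iso_sq/(_ (erefl _))[y /conj_sign[]].
have h_allowed i E : model i E <-> exists2 s, sgn_ok i s & graded_iso E (mdl i s).
  rewrite /model /sgn_ok /mdl; case: ifP => _.
    by split=> [[s]|[s _]]; exists s.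
  by split=> [|[s /eqP->]//]; exists false.
split.
  exact: (@normal_form R N z C (conjR R) conjRK (@complexR_div R) P (@conj_gens R N z)
    model sgn_ok mdl h_norm P_div h_frames h_P h_mdl h_allowed).
exact: (@classification R N z z_basis (numField_neqN1 R) C (conjR R) conjRK
  (@complexR_div R) P (@conj_gens R N z) model sgn_ok mdl h_uniq P_div h_frames h_P
  h_mdl h_inj h_allowed).
Qed.

End Adapted.
End ConjugationCase.

Theorem mainTheorem4 (R : realType) (N : nat) :
  (* (1) *)
  (forall z : N.-tuple 'rV['F_2]_N, basis_of fullv z ->
    let P := fun D : gradedAlg (complex R) 'rV['F_2]_N =>
      full_division_alg D in
    let model := fun (i : 'I_N) (E : gradedAlg (complex R) 'F_2) =>
      graded_iso E (crossed_graded (idData (complex R)^o false)) in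
    [/\ forall D, P D -> gcomp D 0 = 1%VS,
        has_normal_form z P (@square_one_gens (complex R) N z) model
      & classified_by z P (@square_one_gens (complex R) N z) model])
  /\
  (* (2) *)
  (forall z : N.-tuple 'rV['F_2]_N, basis_of fullv z ->
    forall D0 : falgType R,
    alg_iso D0 R^o \/ alg_iso D0 (quaternions R) ->
    let P := fun D : gradedAlg R 'rV['F_2]_N =>
      full_division_alg D /\ degree0_is D D0 in
    let model := fun (i : 'I_N) (E : gradedAlg R 'F_2) =>
      exists s : bool, graded_iso E (crossed_graded (idData D0 s)) in
    has_normal_form z P (@square_sign_gens R N z) model /\
    classified_by z P (@square_sign_gens R N z) model)
  /\
  (* (3) *)
  (forall z : N.-tuple 'rV['F_2]_N, basis_of fullv z ->
    let P := fun D : gradedAlg R 'rV['F_2]_N =>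
      [/\ full_division_alg D, degree0_is D (complexR R)
        & homogeneous_commute0 D] in
    let model := fun (i : 'I_N) (E : gradedAlg R 'F_2) =>
      graded_iso E (crossed_graded (idData (complexR R) false)) in
    [/\ has_normal_form z P (@square_one_gens R N z) model,
        (* the isomorphisms of the D_i with (C, id, 1) can be taken C-linear *)
        forall D, P D ->
          forall phi : {lrmorphism complexR R -> D}, identifies0 phi ->
          forall i : 'I_N,
          exists f : {lrmorphism Z2sub D (tnth z i) ->
                        crossed_graded (idData (complexR R) false)},
            is_graded_iso f /\
            forall (c : complexR R) (x y : Z2sub D (tnth z i)),
              Z2sub_val y = phi c * Z2sub_val x ->
              f y = crossed_in (idData (complexR R) false) c * f x
      & classified_by z P (@square_one_gens R N z) model])
  /\
  (* (4) *)
  (let noncentral := fun D : gradedAlg R 'rV['F_2]_N =>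
      [/\ full_division_alg D, degree0_is D (complexR R)
        & ~ homogeneous_commute0 D] in
    (forall D, noncentral D ->
      exists z : N.-tuple 'rV['F_2]_N, basis_of fullv z /\ adapted D z)
    /\
    (forall z : N.-tuple 'rV['F_2]_N, basis_of fullv z -> (0 < N)%N ->
      let P := fun D => noncentral D /\ adapted D z in
      let model := fun (i : 'I_N) (E : gradedAlg R 'F_2) =>
        if i == 0%N :> nat
        then exists s : bool, graded_iso E (crossed_graded (conjData R s))
        else graded_iso E (crossed_graded (idData (complexR R) false)) in
      has_normal_form z P (@conj_gens R N z) model /\
      classified_by z P (@conj_gens R N z) model)).
Proof.
split; first by move=> z z_basis; apply: classification_complex.
split.
  move=> z z_basis D0 D0_alg; have [D0_div D0_central D0_quat] : central_real_division D0.
    case: D0_alg => /central_real_division_iso; apply.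
      exact: real_central_division.
    exact: quaternions_central_division.
  exact: classification_central.
split; first by move=> z z_basis; apply: classification_complexR.
split; first exact: adapted_basis.
by move=> z z_basis N_gt0; apply: classification_conj.
Qed.
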